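(* Let $g:\mathbb{R}\to[0,+\infty]$ be a function satisfying hypotheses (i) and (ii) stated in the context. Let $f\mathcal{L}^1$ be a finite (signed) measure on $\mathbb{R}$ such that $\operatorname{spt} f=[a,b]$ for some $a,b\in\mathbb{R}$, $\|f\|_{\infty}=M<+\infty$, and the potential $\psi_f$ is constant almost everywhere in $[a,b]$ (that is, there is $c\in\mathbb{R}$ with $\psi_f(x)=c$ for a.e. $x\in[a,b]$). Then $f$ is continuous in $(a,b)$, i.e. $f$ coincides a.e. in $(a,b)$ with a continuous function on $(a,b)$.
   Context: Hypotheses on the kernel $g:\mathbb{R}\to[0,+\infty]$: there is $r>0$ such that (i) $g\in C^1(\mathbb{R}\setminus\{0\})\cap L^1_{loc}(\mathbb{R})$ (in particular $g$ is finite off $0$), $g$ is symmetric ($g(-x)=g(x)$), and $g$ is decreasing in $(0,r)$ (so $g'\le 0$ there); (ii) $g$ is convex in $(0,r)$, $g'$ is concave in $(0,r)$, $g'\in BV_{loc}((0,+\infty))$, and there exists $\Lambda\in(1,+\infty]$ such that $\liminf_{x\to0}\frac{|g'(x/2)|}{|g'(x)|}=\Lambda$ (it is implicit that $g'(x)\ne0$ for $x\neq 0$ close to $0$, so that the quotient is defined). $\mathcal{L}^1$ is Lebesgue measure on $\mathbb{R}$. The function $f:\mathbb{R}\to\mathbb{R}$ is a density, defined up to a.e. equality; $\operatorname{spt} f$ is the support of the measure $f\mathcal{L}^1$ and $\|f\|_\infty$ is the $L^\infty(\mathbb{R})$ norm. The potential of $f$ is $\psi_f(x)=\int_{\mathbb{R}}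 g(x-y)f(y)\,dy$. *)

(* Defs.v *)
From mathcomp Require Export all_boot all_order all_algebra.
From mathcomp Require Export all_classical all_reals all_analysis.
Export Order.TTheory GRing.Theory Num.Theory.
Export numFieldNormedType.Exports.
#[export] Set Implicit Arguments.
#[export] Unset Strict Implicit.
#[export] Unset Printing Implicit Defensive.

Local Open Scope classical_set_scope.
Local Open Scope ring_scope.
Local Open Scope ereal_scope.

Section kernel.
Context {R : realType}.

(* [g] may be infinite at 0 only, so [fine] does not affect the derivative at
   nonzero points, the only ones where it is used. *)
Definition kernel_deriv (g : R -> \bar R) : R -> R := (fine \o g)^`()%classic.

Definition hypothesis_i (g : R -> \bar R) (r : R) : Prop :=
  [/\ (forall x : R, x != 0%R ->
        [/\ g x \is a fin_num, derivable (fine \o g) x 1%R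
          & {for x, continuous (kernel_deriv g)}]),
      (forall K : set R, compact K -> lebesgue_measure.-integrable K g),
      (forall x : R, g (- x)%R = g x)
    & {in `]0%R, r[ &, nonincreasing_fun g}].

(* [kernel_deriv g] is continuous off 0, so its essential variation on a compact
   subinterval of (0, +oo) is its pointwise variation [bounded_variation]. *)
Definition hypothesis_ii (g : R -> \bar R) (r : R) : Prop :=
  [/\ convex_function (E := R^o) [set` `]0%R, r[] (fine \o g),
      convex_function (E := R^o) [set` `]0%R, r[]
        (fun x => - kernel_deriv g x)%R,
      (forall s t : R, (0 < s)%R -> (s <= t)%R ->
        bounded_variation s t (kernel_deriv g)),
      (\forall x \near (0%R : R)^', kernel_deriv g x != 0%R)
    & exists2 Lambda : \bar R, 1 < Lambda &
        limf_einf
          (fun x : R => (`|kernel_deriv g (x / 2)| / `|kernel_deriv g x|)%:E)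
          (0%R : R)^' = Lambda].

(* For a signed [nu], a set is [nu]-null when all its measurable subsets have
   charge 0, i.e. when the total variation of [nu] vanishes on it. *)
Definition charge_support (nu : set R -> \bar R) : set R :=
  ~` \bigcup_(U in [set U : set R | open U /\ nu.-null_set U]) U.

Definition potential (g : R -> \bar R) (f : R -> R) (x : R) : \bar R :=
  \int[lebesgue_measure]_(y in [set: R]) (g (x - y)%R * (f y)%:E).

End kernel.

(* Main.v *)
(** A mollification [u] of [f] is a bounded solution of a nonlocal elliptic
    equation, and its modulus of continuity comes from an Ishii-Lions coupling
    argument.  Taking second differences of [psi_f = c] gives
    [int (g(z+h) + g(z-h) - 2g(z)) u(X-z) dz = 0] for [X] inside [(a,b)].  If
    [u(x0+t) - u(x0-t) > 2M(t/del)^al] for some [t <= del], then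
    [u(x+t) - u(x-t) - 2M(t/del)^al - (2M/d^2)(x-x0)^2] has a positive maximum
    at some [(x,t)].  Subtracting the equations at [x+t] and [x-t] and comparing
    the maximum with its values at [(x,t+z)], [(x,t-z)] (reflection coupling) and
    at [(x+z,t)], [(x-z,t)] (parallel coupling), the concavity of [t^al] yields
    for [3t/8 <= z <= t] a gain of order
    [(t/del)^al (|g'(7t/16)| - |g'(7t/8)|) h^2], by convexity of [g].  The
    condition [Lambda > 1] gives [|g'(x/2)| >= lam |g'(x)|] with [lam > 1]; for
    [2^al <= lam] the gain is at least a multiple of [|g'(del)| h^2], which beats
    the other contributions when [del] is small: they are [O(h^2)] uniformly in
    the mollification, near [0] by integrability of [g] and away from [0] because
    [g'] has bounded variation.  Hence the mollifications are equicontinuous, and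
    they converge to [f] almost everywhere. *)

From HB Require Import structures.
Require Import Defs.
From mathcomp Require Import ring lra measurable_realfun ess_sup_inf.

Local Open Scope classical_set_scope.
Local Open Scope ring_scope.

(** * Integration on the line *)

Section invariance.
Context {R : realType}.
Notation mu := (@lebesgue_measure R).

(** The natural elliptic kernel would be $g''$, which need not be a function since $g'$ only has
    bounded variation; second differences with step $h$ replace it, and every error is measured
    against $h^2$. For $|z| \le h$ these second differences have no sign, whatever the convexity of
    $g$. That region costs $o(h^2)$ for a fixed function, with a factor that grows with the
    regularity constant of the function. This dictates the order of the choices: [del] depends only
    on the kernel, on [M] and on the distance to the endpoints, while [h] is chosen last, after the
    function and the maximum point. The regularity needed is a quadratic bound on second
    differences. One average over an interval only makes a bounded function Lipschitz, so averages
    are taken twice, and the second width tends to 0 with [del] fixed. At the maximum the coupled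
    quantity is compared with $2(u(x+t)-u(x-t))$, which is not small. A constant is annihilated by
    integration against a second difference; the singular part of the kernel is capped in such a way
    that this cancellation survives the localization. *)

Lemma ge0_integral_preserving (phi : measurableTypeR R -> measurableTypeR R)
    (f : R -> \bar R) :
  measurable_fun [set: measurableTypeR R] phi ->
  (forall A : set R, measurable A -> mu (phi @^-1` A) = mu A) ->
  measurable_fun [set: R] f -> (forall x, 0 <= f x)%E ->
  (\int[mu]_x f (phi x) = \int[mu]_x f x)%E.
Proof.
move=> mphi pphi mf f0.
pose phi_ : {mfun _ >-> _} := HB.pack phi (isMeasurableFun.Build _ _ _ _ _ mphi).
transitivity (\int[pushforward mu phi_]_(y in setT) f y)%E.
  by rewrite ge0_integral_pushforward.
by apply: eq_measure_integral => A mA _; exact: pphi.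
Qed.

Lemma integral_preserving (phi : measurableTypeR R -> measurableTypeR R)
    (f : R -> \bar R) :
  measurable_fun [set: measurableTypeR R] phi ->
  (forall A : set R, measurable A -> mu (phi @^-1` A) = mu A) ->
  measurable_fun [set: R] f ->
  (\int[mu]_x f (phi x) = \int[mu]_x f x)%E.
Proof.
move=> mphi pphi mf; rewrite -[LHS]/(\int[mu]_x (f \o phi) x)%E.
rewrite [LHS]integralE [RHS]integralE funepos_comp funeneg_comp; congr (_ - _)%E.
- exact: (ge0_integral_preserving mphi pphi (measurable_funepos mf) (funepos_ge0 _)).
- exact: (ge0_integral_preserving mphi pphi (measurable_funeneg mf) (funeneg_ge0 _)).
Qed.

Lemma lebesgue_measure_unique_oc (phi : measurableTypeR R -> measurableTypeR R) :
  measurable_fun [set: measurableTypeR R] phi ->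
  (forall a b : R, mu (phi @^-1` `]a, b]) = mu `]a, b]%classic) ->
  forall A : set R, measurable A -> mu (phi @^-1` A) = mu A.
Proof.
move=> mphi pphi A mA.
pose phi_ : {mfun _ >-> _} := HB.pack phi (isMeasurableFun.Build _ _ _ _ _ mphi).
rewrite -[LHS]/(pushforward mu phi_ A).
rewrite -(@lebesgue_measure_unique R (pushforward mu phi_))//.
by move=> _ [[a b] _ <-]; exact/esym/pphi.
Qed.

Lemma measurable_addr (c : R) :
  measurable_fun [set: measurableTypeR R]
    (fun x : measurableTypeR R => x + c : measurableTypeR R).
Proof. exact: measurable_funD. Qed.

Lemma measurable_subr (c : R) :
  measurable_fun [set: measurableTypeR R]
    (fun x : measurableTypeR R => c - x : measurableTypeR R).
Proof. exact: measurable_funB. Qed.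

Lemma lebesgue_measure_addr (c : R) (A : set R) : measurable A ->
  mu ((fun x => x + c) @^-1` A) = mu A.
Proof.
apply: lebesgue_measure_unique_oc; first exact: measurable_addr.
move=> a b; have -> : (fun x => x + c) @^-1` `]a, b] = `](a - c), (b - c)]%classic.
  by apply/seteqP; split=> x /=; rewrite !in_itv/= ltrBlDr lerBrDr.
rewrite !lebesgue_measure_itv /= !lte_fin ltrD2r.
by case: ifP => // _; rewrite -!EFinD; congr _%:E; ring.
Qed.

Lemma lebesgue_measure_subr (c : R) (A : set R) : measurable A ->
  mu ((fun x => c - x) @^-1` A) = mu A.
Proof.
apply: lebesgue_measure_unique_oc; first exact: measurable_subr.
move=> a b; have -> : (fun x => c - x) @^-1` `]a, b] = `[(c - b), (c - a)[%classic.
  by apply/seteqP; split=> x /=; rewrite !in_itv/= => /andP[? ?];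
    apply/andP; split; lra.
rewrite !lebesgue_measure_itv /= !lte_fin ltrD2l ltrN2.
by case: ifP => // _; rewrite -!EFinD; congr _%:E; ring.
Qed.

Lemma integral_addr (c : R) (f : R -> \bar R) : measurable_fun [set: R] f ->
  (\int[mu]_x f (x + c)%R = \int[mu]_x f x)%E.
Proof.
exact: (integral_preserving (measurable_addr c) (lebesgue_measure_addr c)).
Qed.

Lemma integral_subr (c : R) (f : R -> \bar R) : measurable_fun [set: R] f ->
  (\int[mu]_x f (c - x)%R = \int[mu]_x f x)%E.
Proof.
exact: (integral_preserving (measurable_subr c) (lebesgue_measure_subr c)).
Qed.

Lemma integrable_addr (c : R) (f : R -> R) :
  mu.-integrable [set: R] (EFin \o f) ->
  mu.-integrable [set: R] (EFin \o (fun x => f (x + c))).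
Proof.
move=> /integrableP[mf fi]; apply/integrableP; split.
  exact: (measurableT_comp mf (measurable_addr c)).
rewrite (integral_addr c (f := fun x => `|(f x)%:E|%E))//.
exact: measurableT_comp.
Qed.

Lemma integrable_subr (c : R) (f : R -> R) :
  mu.-integrable [set: R] (EFin \o f) ->
  mu.-integrable [set: R] (EFin \o (fun x => f (c - x))).
Proof.
move=> /integrableP[mf fi]; apply/integrableP; split.
  exact: (measurableT_comp mf (measurable_subr c)).
rewrite (integral_subr c (f := fun x => `|(f x)%:E|%E))//.
exact: measurableT_comp.
Qed.

Lemma Rintegral_addr (c : R) (f : R -> R) : measurable_fun [set: R] f ->
  \int[mu]_x f (x + c) = \int[mu]_x f x.
Proof.
move=> mf; congr fine; apply: (integral_addr c (f := EFin \o f)).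
exact/measurable_EFinP.
Qed.

Lemma Rintegral_subr (c : R) (f : R -> R) : measurable_fun [set: R] f ->
  \int[mu]_x f (c - x) = \int[mu]_x f x.
Proof.
move=> mf; congr fine; apply: (integral_subr c (f := EFin \o f)).
exact/measurable_EFinP.
Qed.

End invariance.

Section integrable_EFin.
Context d (T : measurableType d) {R : realType} (mu : {measure set T -> \bar R}).

Lemma integrable_EFinB (D : set T) (f g : T -> R) : measurable D ->
  mu.-integrable D (EFin \o f) -> mu.-integrable D (EFin \o g) ->
  mu.-integrable D (EFin \o (fun x => f x - g x)).
Proof. by move=> mD fi gi; have := integrableB mD fi gi. Qed.

Lemma integrable_EFinD (D : set T) (f g : T -> R) : measurable D ->
  mu.-integrable D (EFin \o f) -> mu.-integrable D (EFin \o g) ->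
  mu.-integrable D (EFin \o (fun x => f x + g x)).
Proof. by move=> mD fi gi; have := integrableD mD fi gi. Qed.

Lemma integrable_EFinZl (D : set T) (k : R) (f : T -> R) : measurable D ->
  mu.-integrable D (EFin \o f) ->
  mu.-integrable D (EFin \o (fun x => k * f x)).
Proof. by move=> mD fi; have := integrableZl mD k fi. Qed.

Lemma integrable_EFin_mul_bounded (D : set T) (M : R) (f k : T -> R) : measurable D ->
  mu.-integrable D (EFin \o f) -> measurable_fun D k ->
  (forall x, D x -> `|k x| <= M) ->
  mu.-integrable D (EFin \o (fun x => f x * k x)).
Proof.
move=> mD fi mk kM; have := integrableMl mD fi mk; apply.
by exists M; split; [exact: num_real|move=> x Mx y Dy; exact/(le_trans (kM y Dy))/ltW].
Qed.

End integrable_EFin.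

Section intervals.
Context {R : realType}.
Notation mu := (@lebesgue_measure R).
Implicit Types (f : R -> R) (a b c h k K M : R).

Lemma Rintegral_itv_addr f a b c : measurable_fun [set: R] f ->
  \int[mu]_(x in `[a, b]) f (x + c) = \int[mu]_(x in `[(a + c), (b + c)]) f x.
Proof.
move=> mf; rewrite Rintegral_mkcond [RHS]Rintegral_mkcond.
rewrite -(Rintegral_addr c (f := f \_ `[(a + c), (b + c)])).
  apply: eq_Rintegral => x _; rewrite /patch; congr (if _ then _ else _).
  by apply/idP/idP; rewrite !inE/= !in_itv/= !lerD2r.
by apply/measurable_restrict => //; exact: measurable_funS mf.
Qed.

Lemma integrable_itv_addr f a b c :
  mu.-integrable `[(a + c), (b + c)] (EFin \o f) ->
  mu.-integrable `[a, b] (EFin \o (fun x => f (x + c))).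
Proof.
move=> /integrable_mkcond-/(_ (measurable_itv _)); rewrite restrict_EFin.
move=> /(integrable_addr c) fi; apply/integrable_mkcond => //.
rewrite restrict_EFin; move: fi; congr (_.-integrable _ (_ \o _)).
apply/funext => x; rewrite /patch; congr (if _ then _ else _).
by apply/idP/idP; rewrite !inE/= !in_itv/= !lerD2r.
Qed.

Lemma Rintegral_itv_cat f a b c : a <= b -> b <= c ->
  mu.-integrable `[a, c] (EFin \o f) ->
  \int[mu]_(x in `[a, c]) f x =
  \int[mu]_(x in `[a, b]) f x + \int[mu]_(x in `[b, c]) f x.
Proof.
move=> ab bc fi; have := Rintegral_itvB (x := b) fi.
rewrite !bnd_simp => /(_ ab bc) /eqP; rewrite subr_eq addrC => /eqP ->.
rewrite Rintegral_itv_obnd_cbnd//; apply: integrableS fi => //.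
by apply: subset_itvr; rewrite bnd_simp.
Qed.

(** Telescoping: splitting the integral over [[a, b + h]] in two ways leaves only two end strips of
    width [h]. Applied to first differences of size $O(h)$, this makes integrals of second
    differences $O(h^2)$. *)
Lemma Rintegral_itv_diff f a b h : a <= b -> 0 <= h ->
  measurable_fun [set: R] f ->
  mu.-integrable `[a, (b + h)] (EFin \o f) ->
  \int[mu]_(x in `[a, b]) (f (x + h) - f x) =
  \int[mu]_(x in `[b, (b + h)]) f x - \int[mu]_(x in `[a, (a + h)]) f x.
Proof.
move=> ab h0 mf fi.
have fi1 : mu.-integrable `[a, b] (EFin \o f).
  by apply: integrableS fi => //; apply: subset_itvl; rewrite bnd_simp; lra.
have fi2 : mu.-integrable `[a, b] (EFin \o (fun x => f (x + h))).
  have : mu.-integrable `[(a + h), (b + h)] (EFin \o f).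
    by apply: integrableS fi => //; apply: subset_itvr; rewrite bnd_simp; lra.
  exact: integrable_itv_addr.
rewrite RintegralB// Rintegral_itv_addr//.
have e1 : \int[mu]_(x in `[a, (b + h)]) f x = \int[mu]_(x in `[a, (a + h)]) f x +
    \int[mu]_(x in `[(a + h), (b + h)]) f x.
  by apply: Rintegral_itv_cat => //; lra.
have e2 : \int[mu]_(x in `[a, (b + h)]) f x = \int[mu]_(x in `[a, b]) f x +
    \int[mu]_(x in `[b, (b + h)]) f x.
  by apply: Rintegral_itv_cat => //; lra.
lra.
Qed.

Lemma Rintegral_itv_le f a b K : a <= b ->
  mu.-integrable `[a, b] (EFin \o f) ->
  (forall x, a <= x <= b -> f x <= K) ->
  \int[mu]_(x in `[a, b]) f x <= K * (b - a).
Proof.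
move=> ab fi fK.
have -> : K * (b - a) = \int[mu]_(x in `[a, b]) (fun=> K) x.
  rewrite Rintegral_cst//= lebesgue_measure_itv/= lte_fin.
  by move: ab; rewrite le_eqVlt => /predU1P[->|->]//=; rewrite ltxx subrr.
have Ki : mu.-integrable `[a, b] (EFin \o (fun=> K : R)).
  apply: measurable_bounded_integrable => //.
    by rewrite /= lebesgue_measure_itv/=; case: ifP => // _; rewrite -EFinB ltry.
  exact: bounded_cst.
by apply: le_Rintegral => // x /=; rewrite in_itv/= => /fK.
Qed.

Lemma Rintegral_itv_ge f a b K : a <= b ->
  mu.-integrable `[a, b] (EFin \o f) ->
  (forall x, a <= x <= b -> K <= f x) ->
  K * (b - a) <= \int[mu]_(x in `[a, b]) f x.
Proof.
move=> ab fi fK.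
have := @Rintegral_itv_le (fun x => - f x) a b (- K) ab.
have -> : \int[mu]_(x in `[a, b]) - f x = - \int[mu]_(x in `[a, b]) f x.
  under eq_Rintegral do rewrite -mulN1r.
  by rewrite RintegralZl// mulN1r.
rewrite mulNr lerN2; apply.
  rewrite (_ : _ \o _ = (\- (EFin \o f))%E)//; exact: integrableN.
by move=> x /fK; rewrite lerN2.
Qed.

Lemma Rintegral_itv_norm_le f a b K : a <= b ->
  mu.-integrable `[a, b] (EFin \o f) ->
  (forall x, a <= x <= b -> `|f x| <= K) ->
  `|\int[mu]_(x in `[a, b]) f x| <= K * (b - a).
Proof.
move=> ab fi fK; rewrite ler_norml -mulNr Rintegral_itv_le ?Rintegral_itv_ge//.
- by move=> x /fK; rewrite ler_norml => /andP[].
- by move=> x /fK; rewrite ler_norml => /andP[].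
Qed.

Lemma bounded_integrable_itv f a b M : measurable_fun [set: R] f ->
  (forall x, `|f x| <= M) -> mu.-integrable `[a, b] (EFin \o f).
Proof.
move=> mf fM; apply: measurable_bounded_integrable => //.
- by rewrite /= lebesgue_measure_itv/=; case: ifP => // _; rewrite -EFinB ltry.
- exact: measurable_funS mf.
- by exists M; split; [exact: num_real|move=> x Mx y _; exact/(le_trans (fM y))/ltW].
Qed.

End intervals.

(** * Box averages *)

Section box_average.
Context {R : realType}.
Notation mu := (@lebesgue_measure R).
Implicit Types (f : R -> R) (a b c e h x y z K M : R).

(** Averages over intervals serve as mollifiers: differences of averages are integrals over end
    strips, and almost everywhere convergence is Lebesgue's differentiation theorem. *)
Definition box_average e f x : R :=
  (2 * e)^-1 * \int[mu]_(y in `[- e, e]) f (x + y).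

Lemma measurable_translate f x : measurable_fun [set: R] f ->
  measurable_fun [set: R] (fun y => f (x + y)).
Proof.
move=> mf; have := measurableT_comp mf (measurable_addr x).
by congr measurable_fun; apply/funext => y /=; rewrite addrC.
Qed.

Lemma box_average_diff_le e f M x h : 0 < e -> 0 <= h ->
  measurable_fun [set: R] f -> (forall y, `|f y| <= M) ->
  `|\int[mu]_(y in `[- e, e]) (f (x + y + h) - f (x + y))| <= 2 * M * h.
Proof.
move=> e0 h0 mf fM.
have mk := measurable_translate x mf.
have kM y : `|f (x + y)| <= M by [].
have ki a b := bounded_integrable_itv a b mk kM.
under eq_Rintegral do rewrite -addrA.
rewrite (Rintegral_itv_diff _ _ mk)//; last lra.
apply: (le_trans (ler_normB _ _)).
have H a : `|\int[mu]_(y in `[a, (a + h)]) f (x + y)| <= M * h.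
  have -> : M * h = M * (a + h - a) by ring.
  by apply: Rintegral_itv_norm_le => //; lra.
by rewrite (le_trans (lerD (H _) (H _)))//; lra.
Qed.

Lemma box_average_bound e f M x : 0 < e ->
  measurable_fun [set: R] f -> (forall y, `|f y| <= M) ->
  `|box_average e f x| <= M.
Proof.
move=> e0 mf fM; rewrite /box_average normrM gtr0_norm ?invr_gt0 ?mulr_gt0//.
rewrite ler_pdivrMl ?mulr_gt0// mulrC.
rewrite (_ : M * (2 * e) = M * (e - - e)); last by ring.
apply: Rintegral_itv_norm_le => //; first lra.
exact: (bounded_integrable_itv _ _ (measurable_translate x mf)).
Qed.

Lemma box_average_lip e f M x y : 0 < e ->
  measurable_fun [set: R] f -> (forall y, `|f y| <= M) ->
  `|box_average e f x - box_average e f y| <= M / e * `|x - y|.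
Proof.
move=> e0 mf fM; wlog xy : x y / y <= x.
  move=> H; have [|/ltW yx] := leP y x; first exact: H.
  by rewrite distrC (distrC x) H.
have mx z := measurable_translate z mf.
have ix z : mu.-integrable `[- e, e] (EFin \o (fun y => f (z + y))).
  exact: (bounded_integrable_itv _ _ (mx z)).
rewrite -mulrBr -RintegralB// normrM gtr0_norm ?invr_gt0 ?mulr_gt0//.
rewrite ler_pdivrMl ?mulr_gt0//.
have xy0 : 0 <= x - y by lra.
have := box_average_diff_le y e0 xy0 mf fM.
under eq_Rintegral do rewrite addrAC subrKC.
move=> /le_trans; apply; rewrite ger0_norm//.
by rewrite le_eqVlt; apply/orP; left; apply/eqP; field; lra.
Qed.

Lemma lip_continuous f K : (forall x y, `|f x - f y| <= K * `|x - y|) ->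
  continuous f.
Proof.
move=> fK x; apply/cvgrPdist_lt => eps eps0.
have K0 : 0 < `|K| + 1 by rewrite ltr_wpDl.
near=> y; apply: (le_lt_trans (fK _ _)).
apply: (@le_lt_trans _ _ ((`|K| + 1) * `|x - y|)).
  by rewrite ler_wpM2r// (le_trans (ler_norm _))// lerDl.
rewrite -ltr_pdivlMl//; near: y; apply: cvgr_dist_lt => //.
by rewrite mulr_gt0// invr_gt0.
Unshelve. all: by end_near. Qed.

Lemma continuous_box_average e f M : 0 < e ->
  measurable_fun [set: R] f -> (forall y, `|f y| <= M) ->
  continuous (box_average e f).
Proof.
by move=> e0 mf fM; apply: (@lip_continuous _ (M / e)) => x y; exact: box_average_lip.
Qed.

(** The second difference is the averaged increment of the first difference [F], which is bounded by
    [K * z]; the two end strips of width [z] give the other factor [z]. The input [f] will itself be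
    an average, hence Lipschitz. *)
Lemma box_average_diff2 e f K M x z : 0 < e ->
  measurable_fun [set: R] f -> (forall y, `|f y| <= M) ->
  (forall x y, `|f x - f y| <= K * `|x - y|) ->
  `|box_average e f (x + z) + box_average e f (x - z) - 2 * box_average e f x|
    <= K / e * z ^+ 2.
Proof.
move=> e0 mf fM fK; wlog z0 : z / 0 <= z.
  move=> H; have [|/ltW zN] := leP 0 z; first exact: H.
  have := H (- z); rewrite sqrrN opprK (addrC (box_average _ _ (x - z))).
  by apply; lra.
have mx w := measurable_translate w mf.
have ix w : mu.-integrable `[- e, e] (EFin \o (fun y => f (w + y))).
  exact: (bounded_integrable_itv _ _ (mx w)).
pose F y := f y - f (y - z).
have mF : measurable_fun [set: R] F.
  apply: measurable_funB => //.
  by have := measurable_translate (- z) mf; congr measurable_fun;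
    apply/funext => y /=; rewrite addrC.
have FK y : `|F y| <= K * z.
  by rewrite (le_trans (fK _ _))// subKr ger0_norm.
have := box_average_diff_le x e0 z0 mF FK.
have -> : \int[mu]_(y in `[- e, e]) (F (x + y + z) - F (x + y)) =
  \int[mu]_(y in `[- e, e]) ((f (x + z + y) - f (x + y)) - (f (x + y) - f (x - z + y))).
  by apply: eq_Rintegral => y _; rewrite /F addrK (addrAC x) (addrAC x (- z)).
have iB u v : mu.-integrable `[- e, e] (EFin \o (fun y => f (u + y) - f (v + y))).
  exact: integrable_EFinB.
rewrite !RintegralB// => H.
rewrite (_ : box_average e f (x + z) + _ - _ =
  (2 * e)^-1 * (\int[mu]_(x0 in `[- e, e]) f (x + z + x0) -
       \int[mu]_(x0 in `[- e, e]) f (x + x0) -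
       (\int[mu]_(x0 in `[- e, e]) f (x + x0) -
        \int[mu]_(x0 in `[- e, e]) f (x - z + x0)))); last by rewrite /box_average; ring.
rewrite normrM gtr0_norm ?invr_gt0 ?mulr_gt0// ler_pdivrMl ?mulr_gt0//.
apply: (le_trans H).
by rewrite le_eqVlt; apply/orP; left; apply/eqP; field; lra.
Qed.

Lemma box_average_out e f a b x : 0 < e ->
  (forall y, ~ (a <= y <= b) -> f y = 0) ->
  ~ (a - e <= x <= b + e) -> box_average e f x = 0.
Proof.
move=> e0 f0 xab; rewrite /box_average (@eq_Rintegral _ _ _ mu _ (fun=> 0)).
  by rewrite Rintegral_cst// mul0r mulr0.
move=> y; rewrite inE/= in_itv/= => /andP[ey ye]; apply: f0 => /andP[ay yb].
by apply: xab; apply/andP; split; lra.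
Qed.

Lemma box_average_lip_dist e f K M x : 0 < e ->
  measurable_fun [set: R] f -> (forall y, `|f y| <= M) ->
  (forall x y, `|f x - f y| <= K * `|x - y|) ->
  `|box_average e f x - f x| <= K * e.
Proof.
move=> e0 mf fM fK.
have mx := measurable_translate x mf.
have ix : mu.-integrable `[- e, e] (EFin \o (fun y => f (x + y))).
  exact: (bounded_integrable_itv _ _ mx).
have ic : mu.-integrable `[- e, e] (EFin \o (fun y : R => f x)).
  exact: (@bounded_integrable_itv _ _ _ _ `|f x|).
have K0 : 0 <= K by have := fK 1 0; rewrite subr0 normr1 mulr1; exact: le_trans.
have -> : box_average e f x - f x =
  (2 * e)^-1 * \int[mu]_(y in `[- e, e]) (f (x + y) - f x).
  rewrite RintegralB// Rintegral_cst//= lebesgue_measure_itv/= lte_fin.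
  by rewrite gtrN// -EFinD /box_average/=; field; lra.
rewrite normrM gtr0_norm ?invr_gt0 ?mulr_gt0// ler_pdivrMl ?mulr_gt0//.
rewrite (_ : 2 * e * (K * e) = (K * e) * (e - - e)); last by ring.
apply: Rintegral_itv_norm_le => //; first lra.
- exact: integrable_EFinB.
- move=> y ye; rewrite (le_trans (fK _ _))// addrC addKr ler_wpM2l//.
  by rewrite ler_norml.
Qed.

End box_average.

(** * Potentials and limits of averages *)

Section box_average_limits.
Context {R : realType}.
Notation mu := (@lebesgue_measure R).

Lemma ae_imply (P Q : R -> Prop) : (forall x, P x -> Q x) ->
  {ae mu, forall x, P x} -> {ae mu, forall x, Q x}.
Proof. by move=> PQ; apply: negligibleS => x /= nQ Px; exact/nQ/PQ. Qed.

Lemma ae_and (P Q : R -> Prop) : {ae mu, forall x, P x} ->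
  {ae mu, forall x, Q x} -> {ae mu, forall x, P x /\ Q x}.
Proof.
move=> aP aQ; apply: negligibleS (negligibleU aP aQ) => x /= /not_andP[]; first by left.
by right.
Qed.

Lemma ae_neq (x : R) : {ae mu, forall y, y != x}.
Proof.
exists `[x, x]%classic; split => //.
- by rewrite lebesgue_measure_itv/= lte_fin ltxx.
- by move=> y /= /negP; rewrite negbK => /eqP ->; rewrite in_itv/= lexx.
Qed.

Lemma ae_addr (P : R -> Prop) (c : R) :
  {ae mu, forall x, P x} -> {ae mu, forall x, P (x + c)}.
Proof.
move=> [A [mA A0 PA]]; exists ((fun x => x + c) @^-1` A); split.
- have := measurable_addr c measurableT mA; by rewrite setTI.
- by rewrite lebesgue_measure_addr.
- by move=> x /= Px; apply: PA.
Qed.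

Lemma integral_cst_indic (k a b : R) : a <= b ->
  (\int[mu]_y (k * \1_(`[a, b] : set R) y)%:E = (k * (b - a))%:E)%E.
Proof.
move=> ab; transitivity (\int[mu]_(y in `[a, b]) (cst k%:E y))%E.
  rewrite [RHS]integral_mkcond; apply: eq_integral => y _.
  rewrite /patch indicE; case: ifP => _; first by rewrite mulr1.
  by rewrite mulr0.
rewrite integral_cst//= lebesgue_measure_itv/= lte_fin.
move: ab; rewrite le_eqVlt => /predU1P[->|->]//=.
by rewrite ltxx subrr mulr0 mule0.
Qed.

(** By Fubini the potential of the average is the average of the potential, and the window of
    half-width [e] around [X] stays in [[a, b]]. An equation valid almost everywhere becomes valid
    at every such [X]. *)
Lemma convolution_box_average (k f : R -> R) (M a b c e X : R) : 0 < e ->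
  mu.-integrable [set: R] (EFin \o k) ->
  measurable_fun [set: R] f -> (forall y, `|f y| <= M) ->
  {ae mu, forall x, x \in `[a, b] -> \int[mu]_z (k z * f (x - z)) = c} ->
  a + e <= X <= b - e ->
  \int[mu]_z (k z * box_average e f (X - z)) = c.
Proof.
move=> e0 ki mf fM fc Xab.
pose F (p : measurableTypeR R * measurableTypeR R) : \bar R :=
  (k p.1 * (f (X + p.2 - p.1) * \1_(`[- e, e] : set R) p.2))%:E.
have mk : measurable_fun [set: R] k by apply/measurable_EFinP; exact: measurable_int ki.
have mF : measurable_fun [set: measurableTypeR R * measurableTypeR R] F.
  apply/measurable_EFinP; apply: measurable_funM.
    exact: measurableT_comp.
  apply: measurable_funM.
    apply: measurableT_comp => //; apply: measurable_funB => //.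
    exact: measurable_funD.
  apply: measurableT_comp => //.
have mFn : measurable_fun [set: measurableTypeR R * measurableTypeR R]
  (fun p => `|F p|%E) by exact: measurableT_comp.
have iF : (mu \x mu)%E.-integrable [set: measurableTypeR R * measurableTypeR R] F.
  apply/integrable12ltyP => //.
  apply: (@le_lt_trans _ _ (\int[mu]_x (`|k x| * (M * (2 * e)))%:E)%E).
    apply: ge0_le_integral => //.
    - by move=> x _; exact: integral_ge0.
    - exact: (measurable_fun_fubini_tonelli_F _ mFn (fun p => abse_ge0 (F p))).
    - apply/measurable_EFinP; apply: measurable_funM => //.
      exact: measurableT_comp.
    move=> x _.
    rewrite (_ : _ * _ = `|k x| * M * (e - - e)); last by ring.
    rewrite -integral_cst_indic; last lra.
    apply: ge0_le_integral => //.
    - by apply: measurableT_comp => //; apply: (measurableT_comp mF).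
    - by apply/measurable_EFinP; apply: measurable_funM => //.
    move=> y _; rewrite /F/= lee_fin !normrM -mulrA ler_wpM2l//.
    by rewrite [X in _ * X]ger0_norm ?ler_wpM2r// indicE.
  have : mu.-integrable [set: R] (EFin \o (fun x => (M * (2 * e)) * `|k x|)).
    apply: integrable_EFinZl => //; have := integrable_norm ki; exact.
  move=> /integrableP[_]; apply: le_lt_trans; apply: ge0_le_integral => //.
  - by move=> x _; rewrite lee_fin mulr_ge0// mulr_ge0 ?(le_trans _ (fM 0))//; lra.
  - apply/measurable_EFinP; apply: measurable_funM => //.
    exact: measurableT_comp.
  - apply/measurable_EFinP; apply: measurableT_comp => //.
    by apply: measurable_funM => //; exact: measurableT_comp.
  - by move=> x _; rewrite lee_fin mulrC ler_norm.
have E1 x : (\int[mu]_y F (x, y) = (2 * e * (k x * box_average e f (X - x)))%:E)%E.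
  have -> : 2 * e * (k x * box_average e f (X - x)) =
      k x * \int[mu]_(y in `[- e, e]) f (X - x + y).
    by rewrite /box_average; field; lra.
  rewrite -RintegralZl//; last exact: (bounded_integrable_itv _ _ (measurable_translate _ mf)).
  rewrite Rintegral_mkcond /Rintegral fineK//.
    apply: eq_integral => y _; rewrite /F/= /patch indicE (addrAC X).
    by case: (y \in _); rewrite ?mulr1 ?mulr0.
  apply: integrable_fin_num => //.
  have : mu.-integrable `[- e, e] (EFin \o (fun y => k x * f (X - x + y))).
    apply: integrable_EFinZl => //.
    exact: (bounded_integrable_itv _ _ (measurable_translate _ mf)).
  by move=> /integrable_mkcond-/(_ (measurable_itv _)); rewrite restrict_EFin.
have E2 : (\int[mu]_y \int[mu]_x F (x, y) = (c * (e - - e))%:E)%E.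
  rewrite -integral_cst_indic; last lra.
  apply: ae_eq_integral => //.
  - have := measurable_fubini_G iF; exact.
  - by apply/measurable_EFinP; apply: measurable_funM.
  have fc' := ae_addr X fc.
  apply: ae_imply fc' => y fy _; rewrite indicE.
  case: (boolP (y \in _)) => ye; last first.
    rewrite mulr0; apply: integral0_eq => x _; rewrite /F/= indicE (negbTE ye).
    by rewrite !mulr0.
  rewrite mulr1 -fy; last first.
    by move: ye; rewrite inE/= !in_itv/= => ye; lra.
  rewrite /Rintegral fineK.
    by apply: eq_integral => x _; rewrite /F/= indicE ye mulr1 (addrC y).
  apply: integrable_fin_num => //.
  apply: (@integrable_EFin_mul_bounded _ _ _ _ _ M) => //.
  by have := measurableT_comp mf (measurable_subr (y + X)).
have : (\int[mu]_x (2 * e * (k x * box_average e f (X - x)))%:E = (c * (e - - e))%:E)%E.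
  by rewrite -E2 -(Fubini iF); apply: eq_integral => x _; rewrite E1.
move=> /(congr1 fine) /=; rewrite -[LHS]/(\int[mu]_x (2 * e * (k x * box_average e f (X - x)))).
rewrite RintegralZl//.
  rewrite (_ : c * (e - - e) = 2 * e * c); last by ring.
  by move=> /mulfI; apply; lra.
apply: (@integrable_EFin_mul_bounded _ _ _ _ _ M) => //.
  have := continuous_measurable_fun (continuous_box_average e0 mf fM).
  by move=> mA; have := measurableT_comp mA (measurable_subr X).
by move=> x _; exact: box_average_bound.
Qed.

Lemma ae_box_average_cvg (f : R -> R) : mu.-integrable [set: R] (EFin \o f) ->
  {ae mu, forall x, box_average n.+1%:R^-1 f x @[n --> \oo] --> f x}.
Proof.
move=> fi; pose r (n : nat) : R := n.+1%:R^-1.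
have r0 n : 0 < r n by rewrite invr_gt0.
pose E (x : R) (n : nat) := `[(x - r n), (x + r n)]%classic.
have muE x n : mu (E x n) = (2 * r n)%:E.
  rewrite /E lebesgue_measure_itv/= lte_fin ltrD2l gtrN//= -EFinB.
  by congr _%:E; ring.
have shrink x : nicely_shrinking x (E x).
  split=> [n|]; first exact: measurable_itv.
  have r20 n : 0 < 2 * r n by rewrite mulr_gt0.
  (* The closed interval sits in the open ball of radius [2 * r n], whose measure is twice that of
     the interval. *)
  exists (2, fun n => PosNum (r20 n)); split => //=.
  - rewrite -(mulr0 2); apply: cvgMr; exact: cvg_harmonic.
  - move=> n y; rewrite /E/= in_itv/= /ball/= => /andP[h1 h2].
    by have rn := r0 n; rewrite ltr_norml; apply/andP; split; lra.
  - move=> n; rewrite (lebesgue_measure_ball _ (ltW (r20 n))) muE -EFinM lee_fin.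
    by rewrite /= -[leLHS]mulr_natl lexx.
have mf : measurable_fun [set: R] f.
  by apply/measurable_EFinP; exact: measurable_int fi.
have lf : locally_integrable [set: R] f by exact: (open_integrable_locally openT).
have := lebesgue_differentiation lf; apply: ae_imply => x lx.
have := nice_lebesgue_differentiation shrink lf lx.
move=> /fine_cvg; apply: cvg_trans; apply: near_eq_cvg; near=> n.
rewrite /= muE inver mulf_eq0 /= gt_eqF ?gt_eqF//=.
rewrite /box_average.
have -> : \int[mu]_(y in `[- r n, r n]) f (x + y) = \int[mu]_(y in E x n) f y.
  under eq_Rintegral do rewrite addrC.
  by rewrite Rintegral_itv_addr// /E (addrC (- r n)) (addrC (r n)).
have fiE : mu.-integrable `[(x - r n), (x + r n)] (EFin \o f).
  by have := fi; apply: integrableS.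
by rewrite fineM//; exact: (integrable_fin_num _ fiE).
Unshelve. all: by end_near. Qed.

End box_average_limits.

(** * The coupling argument *)

Section power_barrier.
Context {R : realType}.
Implicit Types (al y t : R).

(** The right-hand side is the tangent at 1 of a concave power. The bound is Young's inequality for
    $x^{al}$ and 1 with exponents $1/al$ and $1/(1-al)$. *)
Lemma powR_le_affine al x : 0 <= al <= 1 -> 0 <= x -> x `^ al <= 1 + al * (x - 1).
Proof.
move=> /andP[a0 a1] x0.
have [->|aN0] := eqVneq al 0; first by rewrite powRr0; lra.
have [->|aN1] := eqVneq al 1; first by rewrite powRr1//; lra.
have al0 : 0 < al by rewrite lt_neqAle eq_sym aN0.
have al1 : 0 < 1 - al by rewrite subr_gt0 lt_neqAle aN1.
have : x `^ al * 1 <= (x `^ al) `^ al^-1 / al^-1 + 1 `^ (1 - al)^-1 / (1 - al)^-1.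
  by apply: conjugate_powR; rewrite ?powR_ge0 ?invr_gt0 ?invrK//; ring.
rewrite -powRrM mulfV// powRr1// powR1 !invrK mulr1; lra.
Qed.

Lemma powR_diff2_le0 al y : 0 <= al <= 1 -> 0 <= y <= 1 ->
  (1 + y) `^ al + (1 - y) `^ al <= 2.
Proof.
move=> a01 /andP[y0 y1].
have := @powR_le_affine al (1 + y) a01; have := @powR_le_affine al (1 - y) a01.
move=> H1 H2; have := lerD (H2 _) (H1 _); rewrite !subr_ge0 y1 addr_ge0//.
by move=> /(_ isT isT) /le_trans; apply; lra.
Qed.

(** With $p=(1+y)^{al}$ and $q=(1-y)^{al}$, concavity for the exponent $2al \le 1$ gives $p^2+q^2\le
    2$, while $pq=(1-y^2)^{al}\le(55/64)^{al}$ because $1-(3/8)^2=55/64$. Hence $(p+q)^2$ stays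
    strictly below 4. *)
Lemma powR_diff2_gap al : 0 < al <= 2^-1 -> exists2 c, 0 < c &
  forall y, 3 / 8 <= y <= 1 -> (1 + y) `^ al + (1 - y) `^ al <= 2 - c.
Proof.
move=> /andP[a0 a1].
pose th : R := (55 / 64) `^ al.
have th1 : th < 1.
  have := @gt0_ltr_powR R al a0 (55/64) 1; rewrite !nnegrE powR1; apply; lra.
have th0 : 0 <= th by exact: powR_ge0.
exists ((1 - th) / 2); first lra.
move=> y /andP[y0 y1].
set p := (1 + y) `^ al; set q := (1 - y) `^ al.
have p0 : 0 <= p by exact: powR_ge0.
have q0 : 0 <= q by exact: powR_ge0.
have pq2 : p ^+ 2 + q ^+ 2 <= 2.
  have : (1 + y) `^ (al * 2%:R) + (1 - y) `^ (al * 2%:R) <= 2 by apply: powR_diff2_le0; lra.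
  by rewrite !powRrM !powR_mulrn ?powR_ge0.
have pq : p * q <= th.
  rewrite -powRM; [|lra|lra].
  by apply: ge0_ler_powR; rewrite ?nnegrE; nra.
by nra.
Qed.

Lemma continuous_norm_powR al : 0 < al -> continuous (fun t => `|t| `^ al).
Proof.
move=> a0 t.
have [->|t0] := eqVneq t 0.
  apply/cvgrPdist_lt => e e0; near=> s.
  rewrite normr0 powR0 ?gt_eqF// sub0r normrN ger0_norm ?powR_ge0//.
  have -> : e = (e `^ al^-1) `^ al by rewrite -powRrM mulVf ?gt_eqF// powRr1// ltW.
  apply: gt0_ltr_powR; rewrite ?nnegrE ?powR_ge0//.
  near: s; have : 0 < e `^ al^-1 by exact: powR_gt0.
  move=> /(cvgr0_norm_lt (@id R) cvg_id); exact.
apply: (@continuous_comp _ _ _ (fun t => `|t|) (fun t => t `^ al)).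
  exact: norm_continuous.
apply/differentiable_continuous/derivable1_diffP.
by apply: derivable_powR; rewrite in_itv/= andbT normr_gt0.
Unshelve. all: by end_near. Qed.

End power_barrier.

(** * Second differences and their transfer under the integral *)

Section second_difference.
Context {R : realType}.
Notation mu := (@lebesgue_measure R).
Implicit Types (k f u : R -> R) (a b c h x z M : R).

Definition diff2 h f z := f (z + h) + f (z - h) - 2 * f z.

Lemma measurable_diff2 h f : measurable_fun [set: R] f ->
  measurable_fun [set: R] (diff2 h f).
Proof.
move=> mf; apply: measurable_funB; last exact: measurable_funM.
apply: measurable_funD; first exact: (measurableT_comp mf (measurable_addr h)).
exact: (measurableT_comp mf (measurable_addr (- h))).
Qed.

Lemma integrable_diff2 h k : mu.-integrable [set: R] (EFin \o k) ->
  mu.-integrable [set: R] (EFin \o diff2 h k).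
Proof.
move=> ki; apply: integrable_EFinB => //; last exact: integrable_EFinZl.
by apply: integrable_EFinD => //; exact: integrable_addr.
Qed.

Lemma Rintegral_diff2_mul h k f M : mu.-integrable [set: R] (EFin \o k) ->
  measurable_fun [set: R] f -> (forall x, `|f x| <= M) ->
  \int[mu]_z (diff2 h k z * f z) = \int[mu]_z (k z * diff2 h f z).
Proof.
move=> ki mf fM.
have mk : measurable_fun [set: R] k by apply/measurable_EFinP; exact: measurable_int ki.
have mfs c : measurable_fun [set: R] (fun z => f (z + c)).
  exact: (measurableT_comp mf (measurable_addr c)).
have ikf c : mu.-integrable [set: R] (EFin \o (fun z => k z * f (z + c))).
  exact: (integrable_EFin_mul_bounded measurableT ki (mfs c) (fun x _ => fM _)).
have ikf' c : mu.-integrable [set: R] (EFin \o (fun z => k (z + c) * f z)).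
  exact: (integrable_EFin_mul_bounded measurableT (integrable_addr c ki) mf (fun x _ => fM x)).
have i0 : mu.-integrable [set: R] (EFin \o (fun z => k z * f z)).
  exact: (integrable_EFin_mul_bounded measurableT ki mf (fun x _ => fM x)).
have sh c : \int[mu]_z (k (z + c) * f z) = \int[mu]_z (k z * f (z - c)).
  rewrite -[RHS](Rintegral_addr c).
    by apply: eq_Rintegral => z _; rewrite addrK.
  exact: measurable_funM.
transitivity (\int[mu]_z (k (z + h) * f z + k (z - h) * f z - 2 * (k z * f z))).
  by apply: eq_Rintegral => z _; rewrite /diff2; ring.
transitivity (\int[mu]_z (k z * f (z - h) + k z * f (z + h) - 2 * (k z * f z))); last first.
  by apply: eq_Rintegral => z _; rewrite /diff2; ring.
have i1 c c' := integrable_EFinD measurableT (ikf c) (ikf c').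
have i1' c c' := integrable_EFinD measurableT (ikf' c) (ikf' c').
have i2 := integrable_EFinZl 2 measurableT i0.
by rewrite !RintegralB// !RintegralD// !sh opprK.
Qed.

Lemma Rintegral_mul_indic (A : set R) f : 
  \int[mu]_z (f z * \1_A z) = \int[mu]_(z in A) f z.
Proof.
rewrite [RHS]Rintegral_mkcond; apply: eq_Rintegral => z _.
by rewrite /patch indicE; case: ifP => _; rewrite ?mulr1 ?mulr0.
Qed.

(** The integral equals the second difference at [X] of the potential of [u], which is [c] at the
    three points involved. *)
Lemma Rintegral_diff2_kernel k u c h X M :
  mu.-integrable [set: R] (EFin \o k) ->
  measurable_fun [set: R] u -> (forall x, `|u x| <= M) ->
  (forall Y, `|Y - X| <= h -> \int[mu]_z (k z * u (Y - z)) = c) -> 0 <= h ->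
  \int[mu]_z (diff2 h k z * u (X - z)) = 0.
Proof.
move=> ki mu_ uM uc h0.
have mu' Y : measurable_fun [set: R] (fun z => u (Y - z)).
  exact: (measurableT_comp mu_ (measurable_subr Y)).
rewrite (Rintegral_diff2_mul h ki (mu' X) (fun x => uM _)).
have ik Y : mu.-integrable [set: R] (EFin \o (fun z => k z * u (Y - z))).
  exact: (integrable_EFin_mul_bounded measurableT ki (mu' Y) (fun x _ => uM _)).
transitivity (\int[mu]_z (k z * u (X - h - z) + k z * u (X + h - z) - 2 * (k z * u (X - z)))).
  apply: eq_Rintegral => z _; rewrite /diff2.
  rewrite (_ : X - (z + h) = X - h - z); last by ring.
  by rewrite (_ : X - (z - h) = X + h - z); last ring; ring.
have i1 Y Y' := integrable_EFinD measurableT (ik Y) (ik Y').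
have i2 := integrable_EFinZl 2 measurableT (ik X).
rewrite !RintegralB// !RintegralD// RintegralZl// !uc; first by ring.
- by rewrite subrr normr0.
- by rewrite (_ : _ - X = h) ?ger0_norm//; ring.
- by rewrite (_ : _ - X = - h) ?normrN ?ger0_norm//; ring.
Qed.

Lemma Rintegral_diff2_kernelN k u c h X M :
  mu.-integrable [set: R] (EFin \o k) -> (forall z, k (- z) = k z) ->
  measurable_fun [set: R] u -> (forall x, `|u x| <= M) ->
  (forall Y, `|Y - X| <= h -> \int[mu]_z (k z * u (Y - z)) = c) -> 0 <= h ->
  \int[mu]_z (diff2 h k z * u (X + z)) = 0.
Proof.
move=> ki kN mu_ uM uc h0; rewrite -(Rintegral_diff2_kernel ki mu_ uM uc h0).
have mk : measurable_fun [set: R] k by apply/measurable_EFinP; exact: measurable_int ki.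
rewrite -[LHS](Rintegral_subr 0).
  apply: eq_Rintegral => z _; rewrite sub0r; congr (_ * _).
  rewrite /diff2 kN -(kN (- z + h)) -(kN (- z - h)) !opprD !opprK.
  by rewrite addrC (addrC (k (z + h))) addrC.
apply: measurable_funM; first exact: measurable_diff2.
exact: measurable_translate.
Qed.

Lemma diff2_near0_small k : mu.-integrable [set: R] (EFin \o k) ->
  forall e : R, 0 < e -> exists2 h0, 0 < h0 & forall h, 0 < h < h0 ->
    \int[mu]_(z in `[- h, h]) `|diff2 h k z| <= e.
Proof.
move=> ki e e0.
have mk : measurable_fun [set: R] k by apply/measurable_EFinP; exact: measurable_int ki.
have e40 : 0 < e / 4 by lra.
have [d [d0 kd]] := integral_normr_continuous ki e40.
exists (d / 2); first lra.
move=> h /andP[h0 hd].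
pose nk (z : R) : R := `|k z|.
have mnk : measurable_fun [set: R] nk by exact: measurableT_comp.
have ink : mu.-integrable [set: R] (EFin \o nk) by exact: integrable_norm ki.
have sh c : \int[mu]_(z in `[- h, h]) nk (z + c) <= e / 4.
  rewrite Rintegral_itv_addr//; apply/ltW/kd => //.
  rewrite /= lebesgue_measure_itv/= lte_fin ifT; last lra.
  by rewrite -EFinB lte_fin; lra.
have inkc c : mu.-integrable `[- h, h] (EFin \o (fun z => nk (z + c))).
  have := integrable_addr c ink; apply: integrableS => //.
have i1 : mu.-integrable `[- h, h] (EFin \o (fun z => nk (z + h) + nk (z - h))).
  exact: integrable_EFinD.
have i2 : mu.-integrable `[- h, h] (EFin \o (fun z => 2 * nk (z + 0))).
  exact: integrable_EFinZl.
have i3 : mu.-integrable `[- h, h]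
  (EFin \o (fun z => nk (z + h) + nk (z - h) + 2 * nk (z + 0))).
  exact: integrable_EFinD.
apply: (@le_trans _ _ (\int[mu]_(z in `[- h, h]) (nk (z + h) + nk (z - h) + 2 * nk (z + 0)))).
  apply: le_Rintegral => //.
    have := integrable_norm (integrable_diff2 h ki); apply: integrableS => //.
  move=> z _; rewrite /diff2 addr0 (le_trans (ler_normB _ _))// normrM ger0_norm//.
  by rewrite lerD2r ler_normD.
rewrite !RintegralD// RintegralZl//.
have := sh h; have := sh (- h); have := sh 0; lra.
Qed.

End second_difference.

(** * The maximum point of the penalized difference *)

Section barrier.
Context {R : realType}.
Notation mu := (@lebesgue_measure R).
Implicit Types (u k : R -> R) (M d del al x t z : R).

Definition barrier M del al t := 2 * M * (`|t| / del) `^ al.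

Definition cross_diff u x t z :=
  u (x + t + z) + u (x + t - z) - u (x - t + z) - u (x - t - z).

(* The first bound on [cross_diff] is the parallel coupling, the second one the
   reflection coupling. *)
Lemma barrier_max u M d del al x0 t1 : continuous u -> (forall x, `|u x| <= M) ->
  0 < M -> 0 < d -> 0 < del -> 0 < al ->
  0 <= t1 <= del -> barrier M del al t1 < u (x0 + t1) - u (x0 - t1) ->
  exists x t, [/\ `|x - x0| <= d, 0 < t <= del,
    barrier M del al t <= u (x + t) - u (x - t),
    (forall z, cross_diff u x t z <=
      2 * (u (x + t) - u (x - t)) + 2 * (2 * M / d ^+ 2) * z ^+ 2) &
    (forall z, 0 <= z <= t -> cross_diff u x t z <=
      2 * (u (x + t) - u (x - t)) +
      (barrier M del al (t + z) + barrier M del al (t - z) - 2 * barrier M del al t))].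
Proof.
move=> cu uM M0 d0 del0 al0 t1del Ht1.
set B := 2 * M / d ^+ 2.
have d20 : 0 < d ^+ 2 by rewrite exprn_gt0.
have B0 : 0 < B by rewrite divr_gt0// mulr_gt0.
set phi := barrier M del al.
have phi_ge0 t : 0 <= phi t by rewrite mulr_ge0 ?powR_ge0// mulr_ge0// ltW.
pose Phi (p : R * R) := u (p.1 + p.2) - u (p.1 - p.2) - phi p.2 - B * (p.1 - x0) ^+ 2.
have cphi : continuous phi.
  have -> : phi = (fun t => 2 * M * `|t / del| `^ al).
    apply/funext => t; rewrite /phi /barrier normrM.
    by rewrite (gtr0_norm (x := del^-1)) ?invr_gt0.
  move=> t; apply: cvgM; first exact: cvg_cst.
  apply: (@continuous_comp R R R (fun t => t / del) (fun t => `|t| `^ al)).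
    exact: cvgMl.
  exact: continuous_norm_powR.
have cPhi : continuous Phi.
  move=> p; apply: cvgB; first apply: cvgB; first apply: cvgB.
  - apply: (@continuous_comp (R * R)%type R R (fun p : R * R => p.1 + p.2) u); last exact: cu.
    by apply: cvgD; [exact: cvg_fst|exact: cvg_snd].
  - apply: (@continuous_comp (R * R)%type R R (fun p : R * R => p.1 - p.2) u); last exact: cu.
    by apply: cvgB; [exact: cvg_fst|exact: cvg_snd].
  - apply: (@continuous_comp (R * R)%type R R snd phi); last exact: cphi.
    exact: cvg_snd.
  - apply: cvgM; first exact: cvg_cst.
    apply: (@continuous_comp (R * R)%type R R (fun p : R * R => p.1 - x0)
      (fun x => x ^+ 2)); last exact: exprn_continuous.
    by apply: cvgB; [exact: cvg_fst|exact: cvg_cst].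
pose A := `[x0 - d, x0 + d]%classic `*` `[0, del]%classic.
have A1 : A (x0, t1) by split; rewrite /= in_itv/=; lra.
have cA : compact A by apply: compact_setX; exact: segment_compact.
have [|[x t] /[!inE] -[/=]] := compact_EVT_max (ex_intro _ _ A1) cA (f := Phi).
  exact: continuous_subspaceT.
rewrite !in_itv/= => xd tdel maxA.
have max0 : 0 < Phi (x, t).
  apply: lt_le_trans (maxA (x0, t1) _); last by rewrite inE.
  by rewrite /Phi/= subrr expr0n/= mulr0 subr0 subr_gt0.
have u2M a b : u a - u b <= 2 * M.
  by have := uM a; have := uM b; rewrite !ler_norml => /andP[? ?] /andP[? ?]; lra.
have max x' t' : 0 <= t' -> Phi (x', t') <= Phi (x, t).
  move=> t'0; have [A'|] := pselect (A (x', t')); first by apply: maxA; rewrite inE.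
  move=> A'; apply/ltW; apply: le_lt_trans max0.
  have Bx : 0 <= B * (x' - x0) ^+ 2 by rewrite mulr_ge0 ?sqr_ge0// ltW.
  have [tdel'|tdel'] := leP t' del.
    have xd' : d ^+ 2 <= (x' - x0) ^+ 2.
      rewrite leNgt; apply/negP => xd'; apply: A'; split; rewrite /= in_itv/=; last lra.
      by apply/andP; split; nra.
    have : B * d ^+ 2 <= B * (x' - x0) ^+ 2 by rewrite ler_pM2l.
    rewrite {1}/B divfK ?gt_eqF// /Phi/= => H.
    by have := u2M (x' + t') (x' - t'); have := phi_ge0 t'; lra.
  have : 2 * M <= phi t'.
    rewrite /phi /barrier ler_peMr//; first lra.
    have -> : 1 = 1 `^ al :> R by rewrite powR1.
    apply: ge0_ler_powR; rewrite ?nnegrE//; first lra.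
    - by rewrite divr_ge0// ltW.
    - by rewrite ger0_norm// ler_pdivlMr// mul1r ltW.
  by rewrite /Phi/=; have := u2M (x' + t') (x' - t'); lra.
have Bx : 0 <= B * (x - x0) ^+ 2 by rewrite mulr_ge0 ?sqr_ge0// ltW.
have t0 : 0 < t.
  rewrite lt_neqAle (andP tdel).1 andbT; apply: contraTneq max0 => <-.
  rewrite -leNgt /Phi/= addr0 subr0 subrr; have := phi_ge0 0; lra.
exists x, t; split.
- by rewrite ler_norml; lra.
- by rewrite t0 (andP tdel).2.
- by move: max0; rewrite /Phi/=; lra.
- move=> z; have := max (x + z) t (ltW t0); have := max (x - z) t (ltW t0).
  rewrite /Phi /cross_diff/= (addrAC x z t) (addrAC x z (- t)) (addrAC x (- z) t) (addrAC x (- z) (- t)).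
  rewrite -/B; nra.
- move=> z /andP[z0 zt].
  have tz1 : 0 <= t + z by lra.
  have tz2 : 0 <= t - z by lra.
  have e1 : x + (t + z) = x + t + z by ring.
  have e2 : x - (t + z) = x - t - z by ring.
  have e3 : x + (t - z) = x + t - z by ring.
  have e4 : x - (t - z) = x - t + z by ring.
  have := max x _ tz1; have := max x _ tz2.
  by rewrite /Phi /cross_diff/= e1 e2 e3 e4 -/phi; lra.
Qed.

End barrier.

(** * Capping the singular part of the kernel *)

Section kernel_cap.
Context {R : realType}.
Notation mu := (@lebesgue_measure R).
Implicit Types (u k : R -> R) (M d del al x t z rho B w h : R).

(** A minimum keeps upper bounds on second differences: whichever of the two functions is the
    smaller at the centre also bounds both neighbours from above. *)
Lemma diff2_min_sqr h z r :
  diff2 h (fun z : R => Num.min (z ^+ 2) (r ^+ 2)) z <= 2 * h ^+ 2.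
Proof.
rewrite /diff2; set a := Num.min (_ ^+ 2) _; set b := Num.min ((z - h) ^+ 2) _.
have a1 : a <= (z + h) ^+ 2 by rewrite ge_min lexx.
have b1 : b <= (z - h) ^+ 2 by rewrite ge_min lexx.
have a2 : a <= r ^+ 2 by rewrite ge_min lexx orbT.
have b2 : b <= r ^+ 2 by rewrite ge_min lexx orbT.
have h2 : 0 <= h ^+ 2 by exact: sqr_ge0.
by rewrite /Num.min; case: ifP => _; nra.
Qed.


(* Subtracting [k rho] does not change second differences, and cutting at
   [|z| = rho] only raises the values of a neighbouring point. *)
Definition kernel_cap k rho z : R := if `|z| < rho then k z - k rho else 0.

Lemma kernel_cap_ge0 k rho z : (forall z, `|z| < rho -> k rho <= k z) ->
  0 <= kernel_cap k rho z.
Proof. by move=> kz; rewrite /kernel_cap; case: ifP => // /kz; rewrite subr_ge0. Qed.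

Lemma integrable_kernel_cap k rho : mu.-integrable [set: R] (EFin \o k) ->
  mu.-integrable [set: R] (EFin \o kernel_cap k rho).
Proof.
move=> ki.
have -> : kernel_cap k rho = (fun z => k z - k rho) \_ `]- rho, rho[.
  apply/funext => z; rewrite /kernel_cap /patch ltr_norml; congr (if _ then _ else _).
  by apply/idP/idP; rewrite inE/= in_itv/=.
have ci : mu.-integrable `]- rho, rho[ (EFin \o (fun=> k rho)).
  apply: measurable_bounded_integrable => //.
    by rewrite /= lebesgue_measure_itv/=; case: ifP => // _; rewrite -EFinB ltry.
  exact: bounded_cst.
have ki' : mu.-integrable `]- rho, rho[ (EFin \o k) by apply: integrableS ki.
have : mu.-integrable `]- rho, rho[ (EFin \o (fun z => k z - k rho)).
  exact: integrable_EFinB.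
by move=> /integrable_mkcond-/(_ (measurable_itv _)); rewrite restrict_EFin.
Qed.

(** [chi] is the bound from the parallel coupling, frozen for $|z|\ge rho$ so that it is bounded.
    Moving the second difference onto [chi] removes the constant [2 * w], and the quadratic part
    contributes at most $4Bh^2$ against a nonnegative weight. *)
Lemma Rintegral_kernel_cap_le k rho B w h : 0 <= B ->
  mu.-integrable [set: R] (EFin \o k) ->
  (forall z, `|z| < rho -> k rho <= k z) ->
  let chi z := 2 * w + 2 * B * Num.min (z ^+ 2) (rho ^+ 2) in
  mu.-integrable [set: R] (EFin \o (fun z => diff2 h (kernel_cap k rho) z * chi z)) /\
  \int[mu]_z (diff2 h (kernel_cap k rho) z * chi z)
      <= 4 * B * h ^+ 2 * \int[mu]_z kernel_cap k rho z.
Proof.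
move=> B0 ki krho chi.
have pi := integrable_kernel_cap rho ki.
have mchi : measurable_fun [set: R] chi.
  apply: measurable_funD => //; apply: measurable_funM => //.
  apply: measurable_minr => //; exact: measurable_funX.
have chiM z : `|chi z| <= 2 * `|w| + 2 * B * rho ^+ 2.
  have m0 : 0 <= Num.min (z ^+ 2) (rho ^+ 2) by rewrite le_min !sqr_ge0.
  rewrite (le_trans (ler_normD _ _))// normrM (ger0_norm (x := 2))// lerD2l.
  by rewrite ger0_norm ?mulr_ge0// ler_wpM2l ?mulr_ge0// ge_min lexx orbT.
have mdchi := measurable_diff2 h mchi.
split.
  exact: (integrable_EFin_mul_bounded measurableT (integrable_diff2 h pi) mchi (fun z _ => chiM z)).
rewrite (Rintegral_diff2_mul h pi mchi chiM) -RintegralZl//.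
have dchi z : diff2 h chi z <= 4 * B * h ^+ 2.
  have := diff2_min_sqr h z rho; rewrite /diff2 /chi => H; nra.
apply: le_Rintegral => //.
- apply: (integrable_EFin_mul_bounded measurableT pi mdchi (M := 4 * (2 * `|w| + 2 * B * rho ^+ 2))) => z _.
  rewrite /diff2 (le_trans (ler_normB _ _))// normrM ger0_norm//.
  have := ler_normD (chi (z + h)) (chi (z - h)).
  by have := chiM (z + h); have := chiM (z - h); have := chiM z; lra.
- exact: integrable_EFinZl.
- by move=> z _; rewrite mulrC ler_wpM2r// kernel_cap_ge0.
Qed.

(** Since [h < rho], the neighbours of a point with $|z|<rho$ stay within [2 * rho], where leaving
    the cap means falling below [k rho]. *)
Lemma diff2_kernel_cap k rho h z : 0 < h < rho ->
  (forall z, `|z| < rho -> k rho <= k z) ->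
  (forall z, rho <= `|z| < 2 * rho -> k z <= k rho) ->
  if `|z| < rho then diff2 h k z <= diff2 h (kernel_cap k rho) z
  else 0 <= diff2 h (kernel_cap k rho) z.
Proof.
move=> /andP[h0 hrho] k1 k2.
have p0 y := kernel_cap_ge0 y k1.
case: ifPn => zr; last first.
  rewrite /diff2 {3}/kernel_cap (negbTE zr) mulr0 subr0; exact: addr_ge0.
have pk y : `|y| < 2 * rho -> k y - k rho <= kernel_cap k rho y.
  rewrite /kernel_cap; case: ifPn => //; rewrite -leNgt => y1 y2.
  by rewrite subr_le0 k2// y1.
have zh : k (z + h) - k rho <= kernel_cap k rho (z + h).
  by apply: pk; rewrite (le_lt_trans (ler_normD _ _))// (gtr0_norm h0); lra.
have zh' : k (z - h) - k rho <= kernel_cap k rho (z - h).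
  by apply: pk; rewrite (le_lt_trans (ler_normB _ _))// (gtr0_norm h0); lra.
by rewrite /diff2 {3}/kernel_cap zr; lra.
Qed.

End kernel_cap.

(** * The coupling inequality *)

Section coupling.
Context {R : realType}.
Notation mu := (@lebesgue_measure R).
Implicit Types (u k J : R -> R) (M d del al x t z rho B w h D V : R).

(* [rho] separates the singular part of the kernel from the part controlled by
   bounded variation, and [D] bounds the distances at which it acts. *)
Record tame_kernel k rho D V h1 al : Prop := TameKernel {
  tame_integrable : mu.-integrable [set: R] (EFin \o k);
  tame_even : forall z, k (- z) = k z;
  tame_above : forall z, `|z| < rho -> k rho <= k z;
  tame_below : forall z, rho <= `|z| < 2 * rho -> k z <= k rho;
  tame_convex : forall h z, 0 < h < `|z| -> `|z| + h < 2 * rho -> 0 <= diff2 h k z;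
  tame_far : forall h, 0 < h < h1 ->
    \int[mu]_(z in `[rho, D]) `|diff2 h k z| <= V * h ^+ 2;
  tame_near : forall K e : R, 0 < e -> exists del, [/\ 0 < del < e, del < rho &
    forall t h, 0 < t <= del -> 0 < h <= t / 16 ->
      K * h ^+ 2 <= (t / del) `^ al * \int[mu]_(z in `[3 / 8 * t, t]) diff2 h k z] }.

Lemma diff2N k h z : (forall z, k (- z) = k z) -> diff2 h k (- z) = diff2 h k z.
Proof.
move=> kN; rewrite /diff2 kN -(kN (- z + h)) -(kN (- z - h)) !opprD !opprK.
by rewrite (addrC (k (z - h))).
Qed.

Lemma indic_itvE (a b y : R) : \1_(`[a, b] : set R) y = (a <= y <= b)%R%:R :> R.
Proof.
rewrite indicE (_ : (y \in _) = (a <= y <= b)%R)//.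
by apply/idP/idP; rewrite inE/= in_itv.
Qed.

Lemma norm_indic_itv_le1 (a b y : R) : `|\1_(`[a, b] : set R) y : R| <= 1.
Proof. by rewrite indic_itvE; case: (_ <= _ <= _); rewrite ?normr1 ?normr0. Qed.

Lemma cross_diff_near0 u C x t z : (forall x z, `|diff2 z u x| <= C * z ^+ 2) ->
  `|cross_diff u x t z - 2 * (u (x + t) - u (x - t))| <= 2 * C * z ^+ 2.
Proof.
move=> uC; have -> : cross_diff u x t z - 2 * (u (x + t) - u (x - t)) =
  diff2 z u (x + t) - diff2 z u (x - t) by rewrite /cross_diff /diff2; ring.
rewrite (le_trans (ler_normB _ _))//.
by have := uC (x + t) z; have := uC (x - t) z; lra.
Qed.

Lemma cross_diff_bound u M x t z : (forall x, `|u x| <= M) ->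
  `|cross_diff u x t z| <= 4 * M.
Proof.
move=> uM; have {}uM a : - M <= u a <= M by rewrite -ler_norml.
rewrite /cross_diff ler_norml.
have := uM (x + t + z); have := uM (x + t - z).
have := uM (x - t + z); have := uM (x - t - z).
by move: (u _) (u _) (u _) (u _) => a b c d'; lra.
Qed.

Lemma measurable_cross_diff u x t : measurable_fun [set: R] u ->
  measurable_fun [set: R] (cross_diff u x t).
Proof.
move=> mu_; apply: measurable_funB; first apply: measurable_funB; first apply: measurable_funD.
- exact: measurable_translate.
- exact: (measurableT_comp mu_ (measurable_subr (x + t))).
- exact: measurable_translate.
- exact: (measurableT_comp mu_ (measurable_subr (x - t))).
Qed.

Lemma Rintegral_diff2_cross_diff k u M c x t h : mu.-integrable [set: R] (EFin \o k) ->
  (forall z, k (- z) = k z) -> measurable_fun [set: R] u -> (forall x, `|u x| <= M) ->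
  0 <= h ->
  (forall Y, `|Y - (x + t)| <= h \/ `|Y - (x - t)| <= h ->
    \int[mu]_z (k z * u (Y - z)) = c) ->
  \int[mu]_z (diff2 h k z * cross_diff u x t z) = 0.
Proof.
move=> ki kN mu_ uM h0 uc.
have Gi := integrable_diff2 h ki.
have i1 X : mu.-integrable [set: R] (EFin \o (fun z => diff2 h k z * u (X + z))).
  exact: (integrable_EFin_mul_bounded measurableT Gi (measurable_translate X mu_) (fun z _ => uM _)).
have i2 X : mu.-integrable [set: R] (EFin \o (fun z => diff2 h k z * u (X - z))).
  exact: (integrable_EFin_mul_bounded measurableT Gi
    (measurableT_comp mu_ (measurable_subr X)) (fun z _ => uM _)).
transitivity (\int[mu]_z ((diff2 h k z * u (x + t + z) + diff2 h k z * u (x + t - z)) -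
    (diff2 h k z * u (x - t + z) + diff2 h k z * u (x - t - z)))).
  by apply: eq_Rintegral => z _; rewrite /cross_diff; ring.
have j1 X := integrable_EFinD measurableT (i1 X) (i2 X).
have ucp Y H := uc Y (or_introl H).
have ucm Y H := uc Y (or_intror H).
rewrite RintegralB// !RintegralD//.
rewrite (Rintegral_diff2_kernel ki mu_ uM ucp h0) (Rintegral_diff2_kernel ki mu_ uM ucm h0).
rewrite (Rintegral_diff2_kernelN ki kN mu_ uM ucp h0) (Rintegral_diff2_kernelN ki kN mu_ uM ucm h0).
by rewrite !addr0 subr0.
Qed.

(** Homogeneity: writing [z = y * t] factors [barrier M del al t] out and leaves the gap for the
    pure power. *)
Lemma barrier_gap M del al gap t z : 0 <= M -> 0 < del -> 0 < t ->
  (forall y : R, 3 / 8 <= y <= 1 -> (1 + y) `^ al + (1 - y) `^ al <= 2 - gap) ->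
  3 / 8 * t <= z <= t ->
  barrier M del al (t + z) + barrier M del al (t - z) - 2 * barrier M del al t <=
    - (gap * barrier M del al t).
Proof.
move=> M0 del0 t0 gapP /andP[z1 z2].
have td : 0 <= t / del by rewrite divr_ge0// ltW.
have [y /andP[y1 y2] ->] : exists2 y, 3 / 8 <= y <= 1 & z = y * t.
  exists (z / t); last by rewrite divfK// gt_eqF.
  by rewrite ler_pdivlMr// ler_pdivrMr// mul1r z1.
have bE s : 0 <= s -> barrier M del al (s * t) = 2 * M * ((t / del) `^ al * s `^ al).
  move=> s0; rewrite /barrier ger0_norm ?mulr_ge0 ?(ltW t0)//.
  by rewrite -(mulrA s) (powRM _ s0 td) (mulrC (s `^ al)).
have e1 : t + y * t = (1 + y) * t by ring.
have e2 : t - y * t = (1 - y) * t by ring.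
have e3 : barrier M del al t = 2 * M * ((t / del) `^ al * 1).
  by have := bE 1 ler01; rewrite mul1r powR1.
rewrite e1 e2 e3 !bE; [|lra|lra].
have H := gapP y; rewrite y1 y2 in H; have {}H := H isT.
have Q0 : 0 <= 2 * M * (t / del) `^ al by rewrite !mulr_ge0// powR_ge0.
have := ler_wpM2l Q0 H; rewrite !mulrA; lra.
Qed.

Definition two_sided (rho D : R) (z : R) : R :=
  \1_(`[rho, D] : set R) z + \1_(`[rho, D] : set R) (- z).

Lemma two_sided_ge0 rho D z : 0 <= two_sided rho D z.
Proof. by rewrite /two_sided !indic_itvE addr_ge0. Qed.

Lemma two_sided_ge1 rho D z : rho <= `|z| -> `|z| <= D -> 1 <= two_sided rho D z.
Proof.
rewrite /two_sided !indic_itvE; have [z0|z0] := leP 0 z.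
  by rewrite ger0_norm// => -> ->; rewrite lerDl.
by rewrite ltr0_norm// => -> ->; rewrite lerDr.
Qed.

Section pointwise.
Variables (k J : R -> R) (rho D M B C w h t gp : R).
Hypotheses (k1 : forall z, `|z| < rho -> k rho <= k z)
  (k2 : forall z, rho <= `|z| < 2 * rho -> k z <= k rho)
  (k3 : forall h z, 0 < h < `|z| -> `|z| + h < 2 * rho -> 0 <= diff2 h k z)
  (M0 : 0 <= M) (B0 : 0 <= B) (w0 : 0 <= w) (h0 : 0 < h) (t0 : 0 < t)
  (ht : h <= t / 16) (trho : t < rho)
  (J1 : forall z, J z <= 2 * w + 2 * B * z ^+ 2)
  (J2 : forall z, 3 / 8 * t <= z <= t -> J z <= 2 * w - gp)
  (J3 : forall z, `|J z - 2 * w| <= C * z ^+ 2)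
  (J4 : forall z, `|J z| <= 4 * M)
  (J5 : forall z, D < `|z| -> J z = 0).
Let G := diff2 h k.
Let chi z := 2 * w + 2 * B * Num.min (z ^+ 2) (rho ^+ 2).

Let chi_ge0 z : 0 <= chi z.
Proof.
have m0 : 0 <= Num.min (z ^+ 2) (rho ^+ 2) by rewrite le_min !sqr_ge0.
by rewrite /chi addr_ge0 ?mulr_ge0// mulr_ge0.
Qed.

Let chiE z : `|z| < rho -> chi z = 2 * w + 2 * B * z ^+ 2.
Proof.
move=> zrho; rewrite /chi min_l// -(real_normK (num_real z)).
by rewrite ler_pXn2r ?nnegrE// ltW// (le_lt_trans _ zrho).
Qed.

Let C_ge0 : 0 <= C.
Proof. by have := J3 1; rewrite expr1n mulr1; exact: le_trans. Qed.

Let Gnear z : `|z| <= h -> G z * J z <=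
  G z * chi z + (C + 2 * B) * h ^+ 2 * `|G z|.
Proof.
move=> zh.
have zrho : `|z| < rho by move: zh ht trho t0; lra.
have z2 : z ^+ 2 <= h ^+ 2.
  by rewrite -(real_normK (num_real z)) ler_pXn2r ?nnegrE// ltW.
have C0 := C_ge0.
have H : `|J z - chi z| <= (C + 2 * B) * h ^+ 2.
  rewrite (chiE zrho) opprD addrA (le_trans (ler_normB _ _))//.
  rewrite (mulrDl C) lerD//.
    by rewrite (le_trans (J3 z))// ler_wpM2l.
  have BB : 0 <= 2 * B by exact: mulr_ge0.
  by rewrite (ger0_norm (mulr_ge0 BB (sqr_ge0 z))) ler_wpM2l.
have : G z * (J z - chi z) <= (C + 2 * B) * h ^+ 2 * `|G z|.
  by rewrite (le_trans (ler_norm _))// normrM mulrC ler_wpM2r.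
by rewrite mulrBr lerBlDl.
Qed.

(** The regions are treated by different means. For $|z|\le h$ the sign of [G] is unknown, but [J]
    and [chi] are both within $O(h^2)$ of [2 * w]. For $h<|z|<rho$ convexity gives [G z >= 0], so
    [J] may be replaced by [chi], or by the better bound [2 * w - gp] on the window. For
    $rho\le|z|\le D$ only the size of [J] is used, and beyond [D] it vanishes; the capped term is
    nonnegative there. The condition [h <= t / 16] keeps the window away from [[- h, h]]. *)
Lemma cross_diff_pointwise z : G z * J z <=
  diff2 h (kernel_cap k rho) z * chi z +
  (C + 2 * B) * h ^+ 2 * (`|G z| * \1_(`[- h, h] : set R) z) +
  4 * M * (`|G z| * two_sided rho D z) -
  gp * (G z * \1_(`[3 / 8 * t, t] : set R) z).
Proof.
have hrho : 0 < h < rho by rewrite h0/=; move: ht trho t0; lra.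
have Ch0 : 0 <= (C + 2 * B) * h ^+ 2.
  by rewrite mulr_ge0 ?sqr_ge0// addr_ge0 ?C_ge0// mulr_ge0.
have near0 : 0 <= (C + 2 * B) * h ^+ 2 * (`|G z| * \1_(`[- h, h] : set R) z).
  by rewrite mulr_ge0// mulr_ge0// indic_itvE.
have far0 : 0 <= 4 * M * (`|G z| * two_sided rho D z).
  by rewrite mulr_ge0 ?mulr_ge0// two_sided_ge0.
have := diff2_kernel_cap z hrho k1 k2.
case: ifPn => [zrho cap|].
  have capchi : G z * chi z <= diff2 h (kernel_cap k rho) z * chi z.
    by rewrite ler_wpM2r// chi_ge0.
  have [zh|hz] := leP `|z| h.
    have -> : \1_(`[3 / 8 * t, t] : set R) z = 0 :> R.
      rewrite indic_itvE; have -> // : 3 / 8 * t <= z = false.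
      apply/negbTE; rewrite -ltNge; have := ler_norm z.
      by move: zh ht t0; lra.
    have := Gnear zh; rewrite mulr0 mulr0 subr0.
    move: near0; rewrite indic_itvE -ler_norml zh mulr1 => _.
    move: far0 capchi; lra.
  have G0 : 0 <= G z.
    by apply: k3; [rewrite h0|move: zrho hrho; lra].
  have GJchi : G z * J z <= G z * chi z by rewrite ler_wpM2l// chiE.
  rewrite (indic_itvE (3 / 8 * t) t z); case: (boolP (_ <= z <= t)) => zt /=.
    have : G z * J z <= G z * (2 * w - gp) by rewrite ler_wpM2l// J2.
    have : G z * (2 * w) <= G z * chi z.
      by rewrite ler_wpM2l// chiE// lerDl mulr_ge0 ?sqr_ge0// mulr_ge0.
    by move: near0 far0 capchi; lra.
  by move: GJchi near0 far0 capchi; lra.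
rewrite -leNgt => zrho cap0.
have capchi : 0 <= diff2 h (kernel_cap k rho) z * chi z by rewrite mulr_ge0 ?chi_ge0.
have -> : \1_(`[3 / 8 * t, t] : set R) z = 0 :> R.
  rewrite indic_itvE; case: (boolP (_ <= _ <= _)) => // /andP[zt1 zt2].
  have z0 : 0 <= z by move: zt1 t0; lra.
  by move: zrho; rewrite ger0_norm//; move: zt2 trho; lra.
have GJ : G z * J z <= 4 * M * (`|G z| * two_sided rho D z).
  have [Dz|zD] := ltP D `|z|; first by rewrite J5// mulr0.
  rewrite (le_trans (ler_norm _))// normrM mulrC.
  apply: (@le_trans _ _ (4 * M * `|G z|)); first by rewrite ler_wpM2r.
  by rewrite ler_wpM2l ?mulr_ge0// ler_peMr// two_sided_ge1.
by rewrite mulr0 mulr0 subr0; move: GJ near0 capchi; lra.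
Qed.

End pointwise.

Lemma Rintegral_two_sided k h rho D :
  mu.-integrable [set: R] (EFin \o k) -> (forall z, k (- z) = k z) ->
  mu.-integrable [set: R] (EFin \o (fun z => `|diff2 h k z| * two_sided rho D z)) /\
  \int[mu]_z (`|diff2 h k z| * two_sided rho D z) =
    2 * \int[mu]_(z in `[rho, D]) `|diff2 h k z|.
Proof.
move=> ki kN.
have Gi := integrable_diff2 h ki.
have ni := integrable_norm Gi.
have i1 : mu.-integrable [set: R]
    (EFin \o (fun z => `|diff2 h k z| * \1_(`[rho, D] : set R) z)).
  by apply: (integrable_EFin_mul_bounded measurableT ni _ (fun y _ => norm_indic_itv_le1 rho D y)).
have i2 : mu.-integrable [set: R]
    (EFin \o (fun z => `|diff2 h k z| * \1_(`[rho, D] : set R) (- z))).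
  have := integrable_subr 0 i1; congr (_.-integrable _ (_ \o _)).
  by apply/funext => z /=; rewrite sub0r diff2N.
have E : (fun z => `|diff2 h k z| * two_sided rho D z) =
    (fun z => `|diff2 h k z| * \1_(`[rho, D] : set R) z +
              `|diff2 h k z| * \1_(`[rho, D] : set R) (- z)).
  by apply/funext => z; rewrite /two_sided mulrDr.
rewrite E; split; first exact: integrable_EFinD.
rewrite RintegralD//.
have -> : \int[mu]_z (`|diff2 h k z| * \1_(`[rho, D] : set R) (- z)) =
    \int[mu]_z (`|diff2 h k z| * \1_(`[rho, D] : set R) z).
  rewrite -[RHS](Rintegral_subr 0).
    by apply: eq_Rintegral => z _; rewrite sub0r diff2N.
  by apply/measurable_EFinP; exact: measurable_int i1.
by rewrite Rintegral_mul_indic; ring.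
Qed.

End coupling.

(** * The modulus of continuity of a regularized solution *)

Section modulus_of_continuity.
Context {R : realType}.
Notation mu := (@lebesgue_measure R).
Implicit Types (u k J : R -> R) (M d del al x t z rho B w h D V : R).

(** The left side of the pointwise bound integrates to 0, so the gain on the window is at most the
    sum of the three errors: capped, near and far. *)
Lemma cross_diff_integrated k J rho D M B C w h t gp :
  mu.-integrable [set: R] (EFin \o k) -> (forall z, k (- z) = k z) ->
  (forall z, `|z| < rho -> k rho <= k z) ->
  (forall z, rho <= `|z| < 2 * rho -> k z <= k rho) ->
  (forall h z, 0 < h < `|z| -> `|z| + h < 2 * rho -> 0 <= diff2 h k z) ->
  0 <= M -> 0 <= B -> 0 <= w -> 0 < h -> 0 < t -> h <= t / 16 -> t < rho ->
  (forall z, J z <= 2 * w + 2 * B * z ^+ 2) ->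
  (forall z, 3 / 8 * t <= z <= t -> J z <= 2 * w - gp) ->
  (forall z, `|J z - 2 * w| <= C * z ^+ 2) ->
  (forall z, `|J z| <= 4 * M) ->
  (forall z, D < `|z| -> J z = 0) ->
  measurable_fun [set: R] J ->
  \int[mu]_z (diff2 h k z * J z) = 0 ->
  gp * \int[mu]_(z in `[3 / 8 * t, t]) diff2 h k z <=
    4 * B * h ^+ 2 * \int[mu]_z kernel_cap k rho z +
    (C + 2 * B) * h ^+ 2 * \int[mu]_(z in `[- h, h]) `|diff2 h k z| +
    8 * M * \int[mu]_(z in `[rho, D]) `|diff2 h k z|.
Proof.
move=> ki kN k1 k2 k3 M0 B0 w0 h0 t0 ht trho J1 J2 J3 J4 J5 mJ GJ0.
have key z := cross_diff_pointwise k1 k2 k3 M0 B0 w0 h0 t0 ht trho J1 J2 J3 J4 J5 z.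
have [capi capP] := Rintegral_kernel_cap_le w h B0 ki k1.
have Gi := integrable_diff2 h ki.
have ni := integrable_norm Gi.
have [fi fE] := Rintegral_two_sided h rho D ki kN.
have i1 : mu.-integrable [set: R]
    (EFin \o (fun z => `|diff2 h k z| * \1_(`[- h, h] : set R) z)).
  by apply: (integrable_EFin_mul_bounded measurableT ni _ (fun y _ => norm_indic_itv_le1 (- h) h y)).
have i3 : mu.-integrable [set: R]
    (EFin \o (fun z => diff2 h k z * \1_(`[3 / 8 * t, t] : set R) z)).
  by apply: (integrable_EFin_mul_bounded measurableT Gi _ (fun y _ => norm_indic_itv_le1 (3 / 8 * t) t y)).
have j1 := integrable_EFinZl ((C + 2 * B) * h ^+ 2) measurableT i1.
have j2 := integrable_EFinZl (4 * M) measurableT fi.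
have j3 := integrable_EFinZl gp measurableT i3.
have j4 := integrable_EFinD measurableT capi j1.
have j5 := integrable_EFinD measurableT j4 j2.
have GJi : mu.-integrable [set: R] (EFin \o (fun z => diff2 h k z * J z)).
  exact: (integrable_EFin_mul_bounded measurableT Gi mJ (fun z _ => J4 z)).
have := le_Rintegral measurableT GJi (integrable_EFinB measurableT j5 j3) (fun z _ => key z).
rewrite GJ0 RintegralB// RintegralD// RintegralD// !RintegralZl//.
rewrite fE !Rintegral_mul_indic.
move: capP; set I1 := \int[mu]_z (diff2 _ _ _ * _); set I2 := \int[mu]_z kernel_cap _ _ _.
move: I1 I2 (Rintegral mu _ _) (Rintegral mu _ _) (Rintegral mu _ _) => a b c d' e.
move=> H1 H2; lra.
Qed.

Lemma modulus_estimate k rho D V h1 al M d :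
  tame_kernel k rho D V h1 al -> 0 < rho -> 0 < h1 -> 0 < al <= 2^-1 ->
  0 < M -> 0 < d ->
  exists2 del, 0 < del & forall u x0 c C, continuous u ->
    (forall x, `|u x| <= M) -> (forall x z, `|diff2 z u x| <= C * z ^+ 2) ->
    (forall X, `|X - x0| <= 2 * d -> \int[mu]_z (k z * u (X - z)) = c) ->
    (forall X z, `|X - x0| <= 2 * d -> D < `|z| -> u (X + z) = 0) ->
    forall t, 0 <= t <= del -> u (x0 + t) - u (x0 - t) <= barrier M del al t.
Proof.
move=> [ki kN kge kle kconv kfar knear] rho0 h10 al0 M0 d0.
have [gap gap0 gapP] := powR_diff2_gap al0.
have [B BE] : exists B, B = 2 * M / d ^+ 2 by exists (2 * M / d ^+ 2).
have B0 : 0 < B by rewrite BE divr_gt0 ?exprn_gt0// mulr_gt0.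
have [P PE] : exists P, P = \int[mu]_z kernel_cap k rho z by eexists.
have gM0 : 0 < 2 * M * gap by rewrite !mulr_gt0.
have d20' : 0 < d / 2 by rewrite divr_gt0.
(* In units of $h^2$ the errors will be [4 * B * P] from the cap, [8 * M * V] from far away and 1
   from near the origin; asking for 2 in place of 1 makes the contradiction strict. The divisor
   [2 * M * gap] is the factor carried by the gain. *)
have [del [/andP[del0 deld] delrho near_del]] :=
  knear ((4 * B * P + 8 * M * V + 2) / (2 * M * gap)) (d / 2) d20'.
exists del => // u x0 c C cu uM uC uc uD t1 t1del; rewrite leNgt; apply/negP => Ht1.
have al1 : 0 < al by case/andP: al0.
have [x [t [xd /andP[t0 tdel] wphi J1 J2]]] := barrier_max cu uM M0 d0 del0 al1 t1del Ht1.
rewrite -BE in J1.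
have phi0 : 0 <= barrier M del al t.
  by rewrite /barrier mulr_ge0 ?powR_ge0// mulr_ge0// ltW.
have w0 := le_trans phi0 wphi.
have mu_ : measurable_fun [set: R] u by exact: continuous_measurable_fun.
have C0 : 0 <= C by have := uC 0 1; rewrite expr1n mulr1; exact: le_trans.
have Cn0 : 0 < 2 * C + 2 * B by rewrite ltr_wpDl ?mulr_ge0// mulr_gt0.
(* The inverse of the factor of the near term, which then costs at most [h ^+ 2] however large [C]
   is; only [h] depends on [C]. *)
have eps0 : 0 < (2 * C + 2 * B)^-1 by rewrite invr_gt0.
have [h0 h00 near0] := diff2_near0_small ki eps0.
have [h [hgt0 hh0 hh1 ht hd]] : exists h, [/\ 0 < h, h < h0, h < h1, h <= t / 16 & h <= d / 2].
  exists (Num.min (Num.min (h0 / 2) (h1 / 2)) (Num.min (t / 16) (d / 2))); split.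
  - by rewrite !lt_min !divr_gt0.
  - by rewrite (@le_lt_trans _ _ (h0 / 2))// ?ge_min ?lexx// ltr_pdivrMr// ltr_pMr// ltr1n.
  - by rewrite (@le_lt_trans _ _ (h1 / 2))// ?ge_min ?lexx ?orbT// ltr_pdivrMr// ltr_pMr// ltr1n.
  - by rewrite !ge_min lexx ?orbT.
  - by rewrite !ge_min lexx ?orbT.
(* The radius [2 * d] splits into [d] for $|x-x0|$, [d / 2] for [t <= del] and [d / 2] for [h]. *)
have nbhx0 X Y s : `|s| <= t -> X = x + s -> `|Y - X| <= h -> `|Y - x0| <= 2 * d.
  move=> st -> YX; have -> : Y - x0 = (Y - (x + s)) + ((x - x0) + s) by ring.
  rewrite (le_trans (ler_normD _ _))//.
  have := ler_normD (x - x0) s; move: YX st xd tdel deld hd.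
  by move: `|_ - _| `|_ - _| `|s| `|_ + _| => r1 r2 r3 r4; lra.
have tt : `|t| <= t by rewrite gtr0_norm.
have tN : `|- t| <= t by rewrite normrN gtr0_norm.
have GJ0 : \int[mu]_z (diff2 h k z * cross_diff u x t z) = 0.
  apply: (Rintegral_diff2_cross_diff ki kN mu_ uM (ltW hgt0) (c := c)) => Y [|] HY; apply: uc.
    exact: nbhx0 tt _ HY.
  exact: nbhx0 tN _ HY.
have J5 z : D < `|z| -> cross_diff u x t z = 0.
  move=> Dz; have X1 : `|x + t - x0| <= 2 * d.
    by apply: (nbhx0 (x + t) _ t) => //; rewrite subrr normr0 ltW.
  have X2 : `|x - t - x0| <= 2 * d.
    by apply: (nbhx0 (x - t) _ (- t)) => //; rewrite subrr normr0 ltW.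
  by rewrite /cross_diff !uD ?normrN// addr0 !subr0.
have J2' z : 3 / 8 * t <= z <= t -> cross_diff u x t z <=
    2 * (u (x + t) - u (x - t)) - gap * barrier M del al t.
  move=> zt; have z0 : 0 <= z <= t.
    case/andP: zt => z1 ->; rewrite andbT; apply: le_trans z1.
    by rewrite mulr_ge0 ?ltW// divr_gt0.
  by rewrite (le_trans (J2 z z0))// lerD2l (barrier_gap (ltW M0) del0 t0 gapP).
have phit : barrier M del al t = 2 * M * (t / del) `^ al.
  by rewrite /barrier gtr0_norm.
have := cross_diff_integrated ki kN kge kle kconv (ltW M0) (ltW B0) w0 hgt0 t0 ht
  (le_lt_trans tdel delrho) J1 J2'
  (fun z => cross_diff_near0 x t z uC) (fun z => cross_diff_bound x t z uM) J5
  (measurable_cross_diff x t mu_) GJ0.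
have hb : 0 < h < h0 by rewrite hgt0.
have hb' : 0 < h < h1 by rewrite hgt0.
have tb : 0 < t <= del by rewrite t0.
have hb'' : 0 < h <= t / 16 by rewrite hgt0.
move: (kfar h hb') (near_del t h tb hb'') (near0 h hb); rewrite phit -PE.
have h20 : 0 < h ^+ 2 by rewrite exprn_gt0.
move: M0 gM0 h20 Cn0; clear.
move: (\int[mu]_(z in `[rho, D]) _) (\int[mu]_(z in `[3 / 8 * t, t]) _)
  (\int[mu]_(z in `[- h, h]) _) (_ `^ _) (h ^+ 2) (2 * C + 2 * B).
move=> F N Q q h2 c M0 gM0 h20 c0 HF HN HQ.
have s1 : c * h2 * Q <= h2.
  rewrite mulrAC ger_pMl// mulrC -ler_pdivlMr// mul1r; exact: HQ.
have s2 : 8 * M * F <= 8 * M * (V * h2) by rewrite ler_wpM2l// mulr_ge0// ltW.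
have s3 : (4 * B * P + 8 * M * V + 2) * h2 <= gap * (2 * M * q) * N.
  have e : 2 * M * gap * ((4 * B * P + 8 * M * V + 2) / (2 * M * gap) * h2) =
      (4 * B * P + 8 * M * V + 2) * h2.
    by rewrite mulrA (mulrC (2 * M * gap)) divfK ?gt_eqF.
  have := ler_wpM2l (ltW gM0) HN; rewrite e => /le_trans; apply.
  by rewrite le_eqVlt; apply/orP; left; apply/eqP; ring.
lra.
Qed.

End modulus_of_continuity.

(** * Kernels satisfying the hypotheses *)

Section convex_derivative.
Context {R : realType}.
Notation mu := (@lebesgue_measure R).
Implicit Types (f : R -> R) (x y z t h r : R).

Lemma convex_function_chord f (D : set R) x y t :
  convex_function (E := R^o) D f -> D x -> D y -> 0 <= t <= 1 ->
  f (t * x + (1 - t) * y) <= t * f x + (1 - t) * f y.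
Proof.
move=> cf Dx Dy /andP[t0 t1].
have := cf (Itv01 t0 t1) x y; rewrite !convRE/= /unstable.onem; apply; exact/mem_set.
Qed.

Lemma derivable_increment f x e : derivable f x 1 -> 0 < e ->
  exists2 d, 0 < d & forall h, `|h| < d ->
    `|f (x + h) - f x - h * f^`()%classic x| <= e * `|h|.
Proof.
move=> /cvg_ex[l fl] e0.
have -> : f^`()%classic x = l by rewrite derive1E; exact: cvg_lim.
move/cvgrPdist_lt : fl => /(_ _ e0) [d /= d0 dP].
exists d => // h hd; have [->|h0] := eqVneq h 0.
  by rewrite addr0 subrr mul0r subr0 !normr0 mulr0.
have := dP h; rewrite /= sub0r normrN => /(_ hd h0) H.
rewrite (_ : _ - _ - _ = (- h) * (l - h^-1 *: (f (h *: 1 + x) - f x))).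
  by rewrite normrM normrN mulrC ler_wpM2r// ltW.
rewrite /GRing.scale/= mulr1 (addrC h); field; exact: h0.
Qed.

Lemma convex_ge_tangent f (D : set R) x y :
  convex_function (E := R^o) D f -> derivable f x 1 -> D x -> D y ->
  f x + f^`()%classic x * (y - x) <= f y.
Proof.
move=> cf df Dx Dy; rewrite leNgt; apply/negP => H.
have [xy|xy] := eqVneq x y; first by move: H; rewrite xy subrr mulr0 addr0 ltxx.
set l := f^`()%classic x in H.
have s0 : 0 < `|y - x| by rewrite normr_gt0 subr_eq0 eq_sym.
(* Half of the supposed deficit per unit length: near [x] the function lies above its tangent minus
   this error, whereas the chord towards [y] forces it down by the full deficit. *)
pose e := (f x + l * (y - x) - f y) / (2 * `|y - x|).
have e0 : 0 < e by rewrite divr_gt0 ?mulr_gt0// subr_gt0.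
have [d d0 dP] := derivable_increment df e0.
pose t := Num.min 2^-1 (d / (2 * `|y - x|)).
have t0 : 0 < t by rewrite lt_min invr_gt0 ltr0n/= divr_gt0// mulr_gt0.
have t1 : t <= 1 by rewrite ge_min; apply/orP; left; lra.
have td : `|t * (y - x)| < d.
  rewrite normrM gtr0_norm// -ltr_pdivlMr//.
  rewrite (@le_lt_trans _ _ (d / (2 * `|y - x|)))//; first by rewrite ge_min lexx orbT.
  by rewrite ltr_pM2l// ltf_pV2 ?posrE ?mulr_gt0// ltr_pMl// ltr1n.
have := dP _ td; rewrite -/l normrM (gtr0_norm t0).
have e2 : e * (t * `|y - x|) = t * ((f x + l * (y - x) - f y) / 2).
  by rewrite /e; field; rewrite gt_eqF.
rewrite e2 ler_norml => /andP[+ _].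
have -> : x + t * (y - x) = t * y + (1 - t) * x by ring.
have := convex_function_chord cf Dy Dx (t := t); rewrite (ltW t0) t1 => /(_ isT).
by nra.
Qed.

End convex_derivative.

(** * Supporting lines and growth under halving *)

Section tangent.
Context {R : realType}.
Notation mu := (@lebesgue_measure R).
Implicit Types (k dk : R -> R) (a b x y z t h r rho lam al : R).

(** Convexity expressed by supporting lines with prescribed slopes: it lets a modified kernel be
    paired with the derivative of the original one. *)
Definition tangent_below k dk r := forall x y,
  0 < x < r -> 0 < y < r -> k x + dk x * (y - x) <= k y.

Lemma tangent_le k dk r x y : tangent_below k dk r ->
  0 < x -> x <= y -> y < r -> dk x <= dk y.
Proof.
move=> T x0; rewrite le_eqVlt => /predU1P[-> //|xy] yr.
have x0r : 0 < x < r by rewrite x0 (lt_trans xy).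
have y0r : 0 < y < r by rewrite (lt_trans x0).
have := T _ _ x0r y0r; have := T _ _ y0r x0r.
by move=> H1 H2; rewrite leNgt; apply/negP => H; nra.
Qed.

Lemma tangent_diff2_ge0 k dk r h z : tangent_below k dk r ->
  0 < h < z -> z + h < r -> 0 <= diff2 h k z.
Proof.
move=> T /andP[h0 hz] zhr.
have z0r : 0 < z < r by lra.
have := T z (z + h) z0r; have := T z (z - h) z0r.
have -> : 0 < z + h < r by lra.
have -> : 0 < z - h < r by lra.
move=> /(_ isT) H1 /(_ isT) H2; rewrite /diff2; lra.
Qed.

(** Telescoping leaves first differences on [[b, b + h]] and [[a, a + h]]. Supporting lines bound
    them below by [h * dk (b - h)] and above by [h * dk (a + h)]. *)
Lemma tangent_Rintegral_diff2_ge k dk r a b h : tangent_below k dk r ->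
  mu.-integrable [set: R] (EFin \o k) -> 0 < h -> h < a -> a <= b -> b + h < r ->
  h ^+ 2 * (dk (b - h) - dk (a + h)) <= \int[mu]_(z in `[a, b]) diff2 h k z.
Proof.
move=> T ki h0 ha ab bhr.
have ki' := integrable_EFinB measurableT ki (integrable_addr (- h) ki).
have qi (s s' : R) : mu.-integrable `[s, s'] (EFin \o (fun z => k z - k (z - h))).
  by apply: integrableS ki'.
have mq : measurable_fun [set: R] (fun z => k z - k (z - h)).
  by apply/measurable_EFinP; exact: measurable_int ki'.
have -> : \int[mu]_(z in `[a, b]) diff2 h k z =
    \int[mu]_(z in `[a, b]) ((k (z + h) - k (z + h - h)) - (k z - k (z - h))).
  by apply: eq_Rintegral => z _; rewrite /diff2 addrK; ring.
rewrite (Rintegral_itv_diff ab (ltW h0) mq (qi _ _)).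
have H1 : h * dk (b - h) * (b + h - b) <= \int[mu]_(x in `[b, (b + h)]) (k x - k (x - h)).
  apply: Rintegral_itv_ge => //; first lra.
  move=> z /andP[bz zb].
  have zh : 0 < z - h < r by lra.
  have zr : 0 < z < r by lra.
  have bh0 : 0 < b - h by lra.
  have bhz : b - h <= z - h by lra.
  have zhr : z - h < r by lra.
  have := T _ _ zh zr; have := tangent_le T bh0 bhz zhr.
  by nra.
have H2 : \int[mu]_(x in `[a, (a + h)]) (k x - k (x - h)) <= h * dk (a + h) * (a + h - a).
  apply: Rintegral_itv_le => //; first lra.
  move=> z /andP[az za].
  have zh : 0 < z - h < r by lra.
  have zr : 0 < z < r by lra.
  have z0 : 0 < z by lra.
  have ahr : a + h < r by lra.
  have := T _ _ zr zh; have := tangent_le T z0 za ahr.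
  by nra.
lra.
Qed.

(** Halving [t] multiplies [kap] by at least [lam], which compensates the loss of a factor $2^{al}$
    in the power. By induction it suffices to treat [del / 2 < t <= del], where the power is at
    least 1/2 because [al <= 1]. *)
Lemma doubling_lower_bound (kap : R -> R) lam al del : 0 < al <= 1 -> 0 < del ->
  2 `^ al <= lam ->
  (forall x, 0 < x <= del -> 0 < kap x) ->
  (forall x, 0 < x <= del -> lam * kap x <= kap (x / 2)) ->
  (forall x, 0 < x <= del -> kap del <= kap x) ->
  forall t, 0 < t <= del -> kap del / 2 <= (t / del) `^ al * kap t.
Proof.
move=> /andP[al0 al1] del0 lam2 kap0 kap2 kapdel.
suff H n t : del / 2 ^+ n.+1 < t <= del -> kap del / 2 <= (t / del) `^ al * kap t.
  move=> t /andP[t0 tdel]; apply: (H (Num.truncn (del / t))).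
  rewrite tdel andbT ltr_pdivrMr ?exprn_gt0// mulrC -ltr_pdivrMr//.
  have := truncnS_gt (del / t); move=> /lt_le_trans; apply.
  by rewrite -natrX ler_nat ltnW// ltn_expl.
elim: n t => [|n IH] t /andP[t1 tdel].
  have t0 : 0 < t by rewrite (lt_trans _ t1)// divr_gt0.
  have kt : kap del <= kap t by apply: kapdel; rewrite t0.
  have kd0 : 0 < kap del by apply: kap0; rewrite del0 lexx.
  have p2 : 2^-1 <= (t / del) `^ al.
    apply: (@le_trans _ _ (t / del)).
      by rewrite ler_pdivlMr// mulrC ltW// -(expr1 2).
    by apply: ger1_powR => //; rewrite divr_gt0//= ler_pdivrMr// mul1r.
  by rewrite mulrC ler_pM// ltW.
have [t2|t2] := ltP (del / 2 ^+ n.+1) t; first by apply: IH; rewrite t2.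
have t0 : 0 < t by rewrite (lt_trans _ t1)// divr_gt0// exprn_gt0.
have half m : 2 * (del / 2 ^+ m.+1) = del / 2 ^+ m.
  by rewrite exprS invfM mulrCA (mulrA 2) mulfV ?pnatr_eq0// mul1r.
have tdel2 : 2 * t <= del.
  apply: (@le_trans _ _ (2 * (del / 2 ^+ n.+1))); first by rewrite ler_pM2l.
  rewrite half ler_pdivrMr ?exprn_gt0//.
  by apply: ler_peMr; [exact: ltW|rewrite exprn_ege1// ler1n].
have := IH (2 * t); rewrite tdel2 andbT.
have -> : del / 2 ^+ n.+1 < 2 * t by rewrite -half ltr_pM2l.
move=> /(_ isT) /le_trans; apply.
have t20 : 0 < 2 * t <= del by rewrite mulr_gt0.
have := kap2 _ t20; rewrite mulrAC mulfV// mul1r => H.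
have -> : 2 * t / del = 2 * (t / del) by rewrite mulrA.
rewrite powRM//; last by rewrite divr_ge0// ltW.
rewrite (mulrC (2 `^ al)) -mulrA ler_wpM2l ?powR_ge0//.
apply: le_trans H; rewrite ler_wpM2r//.
by apply/ltW/kap0.
Qed.

(** Each halving gains a factor [lam > 1], so [kap] blows up along [rho / 2 ^+ n]. This is what lets
    the gain exceed any prescribed constant at a small enough scale. *)
Lemma doubling_unbounded (kap : R -> R) lam rho K e : 1 < lam -> 0 < rho -> 0 < e ->
  (forall x, 0 < x <= rho -> 0 < kap x) ->
  (forall x, 0 < x <= rho -> lam * kap x <= kap (x / 2)) ->
  exists del, [/\ 0 < del < e, del < rho & K <= kap del].
Proof.
move=> lam1 rho0 e0 kap0 kap2.
have lam0 : 0 < lam by rewrite (lt_trans _ lam1).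
have kr : 0 < kap rho by apply: kap0; rewrite rho0 lexx.
have grow n : lam ^+ n * kap rho <= kap (rho / 2 ^+ n).
  elim: n => [|n IH]; first by rewrite expr0 mul1r divr1.
  have -> : rho / 2 ^+ n.+1 = rho / 2 ^+ n / 2 by rewrite exprSr invfM mulrA.
  apply: le_trans (kap2 _ _).
    by rewrite exprS -mulrA ler_wpM2l// ltW.
  rewrite divr_gt0 ?exprn_gt0//= ler_pdivrMr ?exprn_gt0//.
  by apply: ler_peMr; [exact: ltW|rewrite exprn_ege1// ler1n].
have bern n : n%:R * (lam - 1) <= lam ^+ n.
  elim: n => [|n IH]; first by rewrite mul0r expr0.
  rewrite exprS -natr1.
  have : 1 <= lam ^+ n by rewrite exprn_ege1// ltW.
  by nra.
(* With $2^n>n$ the first quotient yields [del < e]; with the Bernoulli bound the second yields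
   [K <= kap del]. *)
pose n := (Num.truncn (rho / e) + Num.truncn (`|K| / (kap rho * (lam - 1)))).+1.
have n1 : rho / e < n%:R.
  rewrite (lt_le_trans (truncnS_gt _))// ler_nat ltnS leq_addr//.
have n2 : `|K| / (kap rho * (lam - 1)) < n%:R.
  rewrite (lt_le_trans (truncnS_gt _))// ler_nat ltnS leq_addl//.
have n2n : n%:R < 2 ^+ n :> R by rewrite -natrX ltr_nat ltn_expl.
have p0 : 0 < 2 ^+ n :> R by rewrite exprn_gt0.
exists (rho / 2 ^+ n); split.
- rewrite divr_gt0//= ltr_pdivrMr// mulrC -ltr_pdivrMr//; exact: lt_trans n2n.
- by rewrite ltr_pdivrMr// ltr_pMr// exprn_egt1// ltr1n.
- apply: le_trans (grow n); apply: (le_trans (ler_norm K)).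
  move: n2; rewrite ltr_pdivrMr ?mulr_gt0 ?subr_gt0// => /ltW /le_trans; apply.
  by rewrite mulrCA mulrC ler_wpM2r// ltW.
Qed.

Lemma doubling_exponent lam : 1 < lam -> exists2 al, 0 < al <= 2^-1 & 2 `^ al <= lam.
Proof.
move=> lam1; have lam0 : 0 < lam by rewrite (lt_trans _ lam1).
have ln2 : 0 < ln 2 :> R by rewrite ln_gt0// ltr1n.
(* The second entry is $\log_2 lam$, the exponent for which $2^{al}=lam$. *)
exists (Num.min 2^-1 (ln lam / ln 2)).
  rewrite lt_min invr_gt0 ltr0n/= ge_min lexx/= andbT.
  by rewrite divr_gt0// ln_gt0.
apply: (@le_trans _ _ (2 `^ (ln lam / ln 2))).
  by apply: ler_powR; rewrite ?ler1n// ge_min lexx orbT.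
by rewrite /powR pnatr_eq0/= divfK ?gt_eqF// lnK.
Qed.

End tangent.

(** * Second differences when the derivative has bounded variation *)

Section bounded_variation.
Context {R : realType}.
Notation mu := (@lebesgue_measure R).
Implicit Types (f k : R -> R) (s x y z h rho D T V : R).

(** Clamping the argument to [[s, T]] gives a function that is nondecreasing and bounded on the
    whole line, hence measurable and integrable on every segment. *)
Definition variation_function s T f x :=
  fine (total_variation s (Num.max s (Num.min x T)) f).

Lemma clamp_itv s T x : s <= T -> s <= Num.max s (Num.min x T) <= T.
Proof. by move=> sT; rewrite le_max lexx/= ge_max sT ge_min lexx orbT. Qed.

Lemma total_variation_fin_num s T f x : bounded_variation s T f -> s <= x <= T ->
  total_variation s x f \is a fin_num.
Proof.
move=> bv /andP[sx xT]; apply/bounded_variationP => //.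
exact: bounded_variationl bv.
Qed.

Lemma variation_function_homo s T f : s <= T -> bounded_variation s T f ->
  {homo variation_function s T f : x y / x <= y}.
Proof.
move=> sT bv x y xy; have cx := clamp_itv x sT; have cy := clamp_itv y sT.
rewrite /variation_function fine_le ?(total_variation_fin_num bv)//.
apply: (@total_variation_nondecreasing _ s T); rewrite ?in_itv//.
by apply: le_max2 => //; exact: le_min2.
Qed.

Lemma variation_function_bound s T f x : s <= T -> bounded_variation s T f ->
  `|variation_function s T f x| <= fine (total_variation s T f).
Proof.
move=> sT bv; have cx := clamp_itv x sT; have /andP[cx1 cx2] := cx.
rewrite ger0_norm; last by rewrite fine_ge0// total_variation_ge0.
rewrite fine_le ?(total_variation_fin_num bv)//; first by rewrite sT lexx.
by apply: (@total_variation_nondecreasing _ s T); rewrite ?in_itv//= sT lexx.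
Qed.

Lemma variation_function_dist s T f x y : bounded_variation s T f ->
  s <= x -> x <= y -> y <= T ->
  `|f y - f x| <= variation_function s T f y - variation_function s T f x.
Proof.
move=> bv sx xy yT; have sy := le_trans sx xy.
rewrite /variation_function !min_l ?(le_trans xy)// !max_r//.
have fx : total_variation s x f \is a fin_num.
  by apply: total_variation_fin_num bv _; rewrite sx (le_trans xy).
have fy : total_variation s y f \is a fin_num.
  by apply: total_variation_fin_num bv _; rewrite sy.
rewrite -fineB// -lee_fin fineK; last by rewrite fin_numB fy.
rewrite (total_variationD f sx xy) addeC addeK//.
exact: total_variation_ge.
Qed.

Lemma mean_value f x y : x < y -> (forall z, x <= z <= y -> derivable f z 1) ->
  exists2 c, x < c < y & f y - f x = f^`()%classic c * (y - x).
Proof.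
move=> xy df.
have [c cxy ->] : exists2 c, c \in `]x, y[ & f y - f x = f^`()%classic c * (y - x).
  apply: MVT => //.
    move=> z /[!in_itv]/= /andP[xz zy]; rewrite derive1E.
    by apply/derivableP/df; rewrite !ltW.
  apply: derivable_within_continuous => z /[!in_itv]/=; exact: df.
by exists c => //; move: cxy; rewrite in_itv.
Qed.

(** By the mean value theorem the second difference is [h] times a difference of two values of the
    derivative, hence at most [h * (v (z + h) - v (z - h))] for the variation function [v]. The
    integral of this increment of step [2 * h] telescopes to two strips, each of size at most
    [2 * h] times the total variation. *)
Lemma bounded_variation_diff2 f k s T rho D h : 0 < h -> s <= rho - h ->
  rho <= D -> D + h <= T ->
  (forall z, s <= z <= T -> derivable f z 1) ->
  bounded_variation s T f^`()%classic ->
  mu.-integrable [set: R] (EFin \o k) ->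
  (forall z, s <= z <= T -> k z = f z) ->
  \int[mu]_(z in `[rho, D]) `|diff2 h k z| <=
    4 * fine (total_variation s T f^`()%classic) * h ^+ 2.
Proof.
move=> h0 srho rhoD DT df bv ki kf.
have sT : s <= T by lra.
set v := variation_function s T f^`()%classic.
set V := fine _.
have vV x : `|v x| <= V by exact: variation_function_bound.
have mv : measurable_fun [set: R] v.
  exact: (nondecreasing_measurable measurableT (variation_function_homo sT bv)).
have mF : measurable_fun [set: R] (fun z => v (z - h)).
  exact: (measurableT_comp mv (measurable_addr (- h))).
have mF' : measurable_fun [set: R] (fun z => v (z + h)).
  exact: (measurableT_comp mv (measurable_addr h)).
have Fi a b := bounded_integrable_itv a b mF (fun z => vV _).
have Fi' a b := bounded_integrable_itv a b mF' (fun z => vV _).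
have key z : rho <= z <= D -> `|diff2 h k z| <= h * (v (z + h) - v (z - h)).
  move=> /andP[rz zD].
  have zr : [&& s <= z, z <= T, s <= z + h, z + h <= T, s <= z - h & z - h <= T].
    by apply/and5P; split; last (apply/andP; split); lra.
  move: zr => /and5P[zr1 zr2 zr3 zr4 /andP[zr5 zr6]].
  rewrite /diff2 !kf ?zr1 ?zr2 ?zr3 ?zr4 ?zr5 ?zr6//.
  have zh1 : z < z + h by lra.
  have zh2 : z - h < z by lra.
  have df1 y : z <= y <= z + h -> derivable f y 1 by move=> yz; apply: df; lra.
  have df2 y : z - h <= y <= z -> derivable f y 1 by move=> yz; apply: df; lra.
  have [c1 c1z e1] := mean_value zh1 df1.
  have [c2 c2z e2] := mean_value zh2 df2.
  have -> : f (z + h) + f (z - h) - 2 * f z = h * (f^`()%classic c1 - f^`()%classic c2).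
    have -> : f (z + h) + f (z - h) - 2 * f z = (f (z + h) - f z) - (f z - f (z - h)) by ring.
    by rewrite e1 e2; ring.
  rewrite normrM gtr0_norm//; apply: ler_wpM2l; first exact: ltW.
  have sc : s <= c2 by lra.
  have cc : c2 <= c1 by lra.
  have cT : c1 <= T by lra.
  apply: (le_trans (variation_function_dist bv sc cc cT)).
  by apply: lerB; apply: variation_function_homo => //; lra.
have mI : measurable (`[rho, D]%classic : set (measurableTypeR R)) by [].
have i1 : mu.-integrable `[rho, D] (EFin \o (fun z => v (z + h) - v (z - h))).
  exact: (integrable_EFinB mI (Fi' _ _) (Fi _ _)).
have i2 : mu.-integrable `[rho, D] (EFin \o (fun z => h * (v (z + h) - v (z - h)))).
  exact: (integrable_EFinZl h mI i1).
have i3 : mu.-integrable `[rho, D] (EFin \o (fun z => `|diff2 h k z|)).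
  by have := integrable_norm (integrable_diff2 h ki); apply: integrableS.
have key' z : `[rho, D]%classic z -> `|diff2 h k z| <= h * (v (z + h) - v (z - h)).
  by rewrite /= in_itv/=; exact: key.
apply: (le_trans (le_Rintegral mI i3 i2 key')).
rewrite RintegralZl//.
have shift z : z + 2 * h - h = z + h by ring.
have -> : \int[mu]_(z in `[rho, D]) (v (z + h) - v (z - h)) =
    \int[mu]_(z in `[rho, D]) (v (z + 2 * h - h) - v (z - h)).
  by under [RHS]eq_Rintegral do rewrite shift.
have h20 : 0 <= 2 * h by lra.
rewrite (Rintegral_itv_diff rhoD h20 mF (Fi _ _)).
have H a : `|\int[mu]_(x in `[a, (a + 2 * h)]) v (x - h)| <= V * (2 * h).
  have -> : V * (2 * h) = V * (a + 2 * h - a) by ring.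
  by apply: Rintegral_itv_norm_le => //; lra.
have H1 := H D; have H2 := H rho.
move: H1 H2; rewrite !ler_norml => /andP[_ H1] /andP[H2 _].
have -> : 4 * V * h ^+ 2 = h * (4 * V * h) by ring.
by apply: ler_wpM2l; [exact: ltW|lra].
Qed.

End bounded_variation.

(** * The gain near the singularity *)

Section kernel_near_zero.
Context {R : realType}.
Notation mu := (@lebesgue_measure R).
Implicit Types (k dk : R -> R) (x y z t h r rho lam al D L : R).

Lemma limf_einf_ratio (F : R -> R) (Lambda : \bar R) : (1 < Lambda)%E ->
  limf_einf (fun x => (F x)%:E) (0 : R)^' = Lambda ->
  exists2 lam, 1 < lam & \forall x \near (0 : R)^', lam <= F x.
Proof.
move=> L1; rewrite limf_einfE => LE; move: L1; rewrite -LE => /ereal_sup_gt[y [V V0 <-]] Vy.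
have [lam lam1 lamV] : exists2 lam, 1 < lam &
    (lam%:E <= ereal_inf ((fun x => (F x)%:E) @` V))%E.
  (* An infinite infimum can occur, for instance when [Lambda] is infinite; any real number above 1
     then serves. *)
  case: (ereal_inf _) Vy => [l|_|//]; first by rewrite lte_fin => l1; exists l.
  by exists 2; rewrite ?ltr1n// leey.
exists lam => //; apply: filterS V0 => x Vx.
by rewrite -lee_fin (le_trans lamV)//; apply: ereal_inf_lbound; exists x.
Qed.

Lemma near_dnbhs0 (P : R -> Prop) : (\forall x \near (0 : R)^', P x) ->
  exists2 e, 0 < e & forall x, 0 < x < e -> P x.
Proof.
move=> [e /= e0 eP]; exists e => // x /andP[x0 xe]; apply: eP.
  by rewrite /= sub0r normrN gtr0_norm.
by rewrite gt_eqF.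
Qed.

(** The fractions are chosen to fit one halving: for [h <= t / 16], $3/8+1/16=7/16$ is half of
    $7/8\le 1-1/16$. So the slopes at [t - h] and [3 / 8 * t + h] differ by at least those at
    [7 / 8 * t] and its half, that is, by [(lam - 1) * - dk (7 / 8 * t)]. *)
Lemma tangent_tame_near k dk rho lam al (K e : R) : tangent_below k dk (4 * rho) ->
  mu.-integrable [set: R] (EFin \o k) -> 0 < rho -> 1 < lam -> 0 < al <= 2^-1 ->
  2 `^ al <= lam ->
  (forall x, 0 < x <= rho -> dk x < 0) ->
  (forall x, 0 < x <= rho -> lam * - dk x <= - dk (x / 2)) ->
  0 < e -> exists del, [/\ 0 < del < e, del < rho &
    forall t h, 0 < t <= del -> 0 < h <= t / 16 ->
      K * h ^+ 2 <= (t / del) `^ al * \int[mu]_(z in `[3 / 8 * t, t]) diff2 h k z].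
Proof.
move=> T ki rho0 lam1 /andP[al0 al1] lam2 dk0 dk2 e0.
have kap0 x : 0 < x <= rho -> 0 < - dk x by move=> /dk0; rewrite oppr_gt0.
(* The factor 2 pays for the 1/2 in the dyadic lower bound, and [lam - 1] is the factor gained by
   halving. *)
have [del [/andP[del0 dele] delrho delK]] :=
  doubling_unbounded (2 * K / (lam - 1)) lam1 rho0 e0 kap0 dk2.
exists del; split => //; first by rewrite del0.
move=> t h tdel /andP[h0 ht]; have /andP[t0 tdel'] := tdel.
have sub x : 0 < x <= del -> 0 < x <= rho.
  by move=> /andP[-> xd]; rewrite (le_trans xd)// ltW.
have al01 : 0 < al <= 1 by rewrite al0 (le_trans al1)// invf_le1// ler1n.
have mono x : 0 < x <= del -> - dk del <= - dk x.
  move=> /andP[x0 xd]; rewrite lerN2; apply: (tangent_le T x0 xd).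
  by rewrite (lt_trans delrho)// ltr_pMl// ltr1n.
have low := doubling_lower_bound al01 del0 lam2 (fun x H => kap0 x (sub x H))
  (fun x H => dk2 x (sub x H)) mono tdel.
have q0 : 0 <= (t / del) `^ al by exact: powR_ge0.
have rr : t <= rho by rewrite (le_trans tdel')// ltW.
have I1 : h ^+ 2 * ((lam - 1) * - dk t) <= \int[mu]_(z in `[3 / 8 * t, t]) diff2 h k z.
  have ha : h < 3 / 8 * t by lra.
  have ab : 3 / 8 * t <= t by lra.
  have bh : t + h < 4 * rho by lra.
  apply: (le_trans _ (tangent_Rintegral_diff2_ge T ki h0 ha ab bh)).
  apply: ler_wpM2l; first exact: sqr_ge0.
  have a1 : 0 < 7 / 8 * t by lra.
  have a2 : 7 / 8 * t <= t - h by lra.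
  have a3 : t - h < 4 * rho by lra.
  have a4 : 0 < 3 / 8 * t + h by lra.
  have a5 : 3 / 8 * t + h <= 7 / 8 * t / 2 by lra.
  have a6 : 7 / 8 * t / 2 < 4 * rho by lra.
  have a7 : 0 < 7 / 8 * t <= rho by lra.
  have a8 : 7 / 8 * t <= t by lra.
  have a9 : t < 4 * rho by lra.
  have m1 := tangent_le T a1 a2 a3.
  have m2 := tangent_le T a4 a5 a6.
  have m3 := dk2 _ a7.
  have m4 := tangent_le T a1 a8 a9.
  have : (lam - 1) * - dk t <= (lam - 1) * - dk (7 / 8 * t).
    by rewrite ler_wpM2l ?lerN2// subr_ge0 ltW.
  lra.
apply: (le_trans _ (ler_wpM2l q0 I1)).
have -> : (t / del) `^ al * (h ^+ 2 * ((lam - 1) * - dk t)) =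
  (lam - 1) * ((t / del) `^ al * - dk t) * h ^+ 2 by ring.
rewrite ler_wpM2r ?sqr_ge0//.
have l10 : 0 < lam - 1 by rewrite subr_gt0.
have : (lam - 1) * (- dk del / 2) <= (lam - 1) * ((t / del) `^ al * - dk t).
  by rewrite ler_wpM2l// ltW.
apply: le_trans; move: delK; rewrite ler_pdivrMr//; lra.
Qed.

End kernel_near_zero.

(** * An integrable kernel that agrees with [g] at the relevant distances *)

Section kernel_truncation.
Context {R : realType}.
Notation mu := (@lebesgue_measure R).
Implicit Types (g : R -> \bar R) (f : R -> R) (x y z t h r rho lam al D L : R).

(* The value at 0 does not affect potentials; [f rho] keeps [kernel_cap] nonnegative. *)
Definition kernel_cut f rho L z : R :=
  if z == 0 then f rho else if `|z| <= L then f z else 0.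

Lemma kernel_cutE f rho L z : 0 < `|z| <= L -> kernel_cut f rho L z = f z.
Proof. by rewrite normr_gt0 /kernel_cut => /andP[/negbTE -> ->]. Qed.

Lemma kernel_cut_norm f rho L z : (forall x, f (- x) = f x) ->
  kernel_cut f rho L `|z| = kernel_cut f rho L z.
Proof.
move=> fN; rewrite /kernel_cut normr_eq0 normr_id.
by have [z0|z0] := leP 0 z; [rewrite ger0_norm|rewrite ltr0_norm// fN].
Qed.

Lemma integrable_kernel_cut g rho L : 0 <= L ->
  (forall x, x != 0 -> g x \is a fin_num) ->
  mu.-integrable `[- L, L] g ->
  mu.-integrable [set: R] (EFin \o kernel_cut (fine \o g) rho L).
Proof.
move=> L0 gfin gi.
(* The origin is removed because [g] may be infinite there. *)
pose A : set R := `[- L, L] `\` `[0, 0].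
have mA : measurable (A : set (measurableTypeR R)) by exact: measurableD.
have gA : mu.-integrable A g.
  by apply: (integrableS _ mA _ gi) => //; exact: subDsetl.
have fA : mu.-integrable A (EFin \o (fine \o g)).
  apply: eq_integrable gA => // x /[!inE] -[_ /=].
  rewrite in_itv/= => x0; rewrite fineK//; apply: gfin.
  by apply: contra_notN x0 => /eqP ->; rewrite lexx.
have i1 : mu.-integrable [set: R] (EFin \o ((fine \o g) \_ A)).
  by move: fA => /integrable_mkcond-/(_ mA); rewrite restrict_EFin.
have i2 : mu.-integrable [set: R] (EFin \o ((fun=> fine (g rho)) \_ (`[0, 0] : set R))).
  rewrite -restrict_EFin.
  have : mu.-integrable `[0, 0] (EFin \o (fun=> fine (g rho))).
    exact: (@bounded_integrable_itv _ _ _ _ `|fine (g rho)|).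
  by move=> /integrable_mkcond-/(_ (measurable_itv _)).
have := integrable_EFinD measurableT i1 i2.
congr (_.-integrable _ (_ \o _)); apply/funext => x; rewrite /kernel_cut /patch /A.
have e0 : (x \in `[0, 0]%classic) = (x == 0).
  by apply/idP/idP; rewrite inE/= in_itv/= -eq_le eq_sym.
have eA : (x \in `[- L, L] `\` `[0, 0]) = (`|x| <= L) && (x != 0).
  apply/idP/idP; rewrite inE/= !in_itv/= -eq_le (eq_sym 0) ler_norml.
    by move=> [-> /negP ->].
  by move=> /andP[-> /negP].
rewrite e0 eA; have [->|x0] := eqVneq x 0; first by rewrite andbF add0r.
by rewrite andbT addr0.
Qed.

Lemma exists_tame_kernel g r D : 0 < r ->
  hypothesis_i g r -> hypothesis_ii g r -> 0 < D ->
  exists k rho V h1 al, [/\ tame_kernel k rho D V h1 al, 0 < rho, 0 < h1,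
    0 < al <= 2^-1 & forall z, 0 < `|z| <= D -> (k z)%:E = g z].
Proof.
move=> r0 [gsm gint gN gdec] [gcvx _ gbv gnz [Lambda L1 LE]] D0.
set f := fine \o g.
have fN x : f (- x) = f x by rewrite /f/= gN.
have gfin x : x != 0 -> g x \is a fin_num by move=> /gsm[].
have fdec x y : 0 < x -> x <= y -> y < r -> f y <= f x.
  move=> x0 xy yr; have y0 := lt_le_trans x0 xy.
  rewrite /f/= fine_le ?gfin ?gt_eqF//.
  by apply: gdec; rewrite ?in_itv//= ?y0// x0 (le_lt_trans xy).
have df x : 0 < x -> derivable f x 1 by move=> x0; case: (gsm x (lt0r_neq0 x0)) => _ d _; exact: d.
have [e1 e10 nz] := near_dnbhs0 gnz.
have [lam lam1 /near_dnbhs0[e2 e20 ratio]] := limf_einf_ratio L1 LE.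
have [al al0 lam2] := doubling_exponent lam1.
(* The margin 1 lets second differences at distance at most [D], with step below 1, ignore the
   truncation. *)
pose L := D + 1.
have [rho [rho0 rhor rhoD rhoe1 rhoe2]] : exists rho,
    [/\ 0 < rho, 4 * rho <= r, 4 * rho <= D, rho < e1 & rho < e2].
  exists (Num.min (Num.min (r / 4) (D / 4)) (Num.min (e1 / 2) (e2 / 2))); split.
  - by rewrite !lt_min !divr_gt0.
  - by rewrite mulrC -ler_pdivlMr// !ge_min lexx.
  - by rewrite mulrC -ler_pdivlMr// !ge_min lexx ?orbT.
  - by rewrite (@le_lt_trans _ _ (e1 / 2))// ?ge_min ?lexx ?orbT// ltr_pdivrMr// ltr_pMr// ltr1n.
  - by rewrite (@le_lt_trans _ _ (e2 / 2))// ?ge_min ?lexx ?orbT// ltr_pdivrMr// ltr_pMr// ltr1n.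
pose k := kernel_cut f rho L.
have kN z : k (- z) = k z.
  by rewrite /k -kernel_cut_norm// normrN kernel_cut_norm.
have kabs z : k `|z| = k z by exact: kernel_cut_norm.
have kf z : 0 < z <= L -> k z = f z.
  by move=> /andP[z0 zL]; rewrite /k kernel_cutE// gtr0_norm// z0.
have ki : mu.-integrable [set: R] (EFin \o k).
  apply: integrable_kernel_cut => //; first by rewrite /L; lra.
  by apply: gint; exact: segment_compact.
set dk := kernel_deriv g.
have small x : 0 < x < 4 * rho -> [/\ 0 < x, x < r & x <= L].
  by move=> /andP[? ?]; rewrite /L; split; lra.
have T : tangent_below k dk (4 * rho).
  move=> x y /small[x0 xr xL] /small[y0 yr yL].
  rewrite !kf ?x0 ?y0//; apply: (convex_ge_tangent gcvx (df x x0)).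
    by rewrite /= in_itv/= x0.
  by rewrite /= in_itv/= y0.
have kdec x y : 0 < x -> x <= y -> y < 4 * rho -> k y <= k x.
  move=> x0 xy yr; have y0 := lt_le_trans x0 xy.
  have [_ ? ?] : [/\ 0 < y, y < r & y <= L] by apply: small; rewrite y0.
  rewrite !kf ?y0 ?x0 ?(le_trans xy)//; exact: fdec.
(* The supporting line at [x], evaluated at [2 * x], together with monotonicity gives [dk x <= 0];
   nonvanishing near 0 makes it strict. *)
have dk0 x : 0 < x <= rho -> dk x < 0.
  move=> /andP[x0 xr]; rewrite lt_neqAle nz ?x0 ?(le_lt_trans xr)//=.
  have xx : 0 < x < 4 * rho by lra.
  have xx2 : 0 < 2 * x < 4 * rho by lra.
  have := T x (2 * x) xx xx2; have := @kdec x (2 * x) x0.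
  have -> : x <= 2 * x by lra.
  have -> : 2 * x < 4 * rho by lra.
  move=> /(_ isT isT) H1 H2; rewrite leNgt; apply/negP => H; nra.
have dk2 x : 0 < x <= rho -> lam * - dk x <= - dk (x / 2).
  move=> /andP[x0 xr].
  have dx : dk x < 0 by apply: dk0; rewrite x0.
  have dx2 : dk (x / 2) < 0 by apply: dk0; lra.
  have := ratio x; rewrite x0 (le_lt_trans xr)// => /(_ isT).
  by rewrite !ltr0_norm// ler_pdivlMr// oppr_gt0.
(* With [h < rho / 2] and [h < 1], the points [z - h] and [z + h] for [z] in [[rho, D]] lie in
   [[rho / 2, L]], where the variation of the derivative is taken. *)
exists k, rho, (4 * fine (total_variation (rho / 2) L dk)), (Num.min (rho / 2) 1), al.
have zrho z : `|z| < 2 * rho -> `|z| < 4 * rho by lra.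
split => //; last 1 first.
- move=> z /andP[z0 zD]; rewrite /k kernel_cutE ?z0 /L/=; last lra.
  by rewrite /f/= fineK// gfin// -normr_gt0.
- split => //.
  + move=> z zr; have [->|z0] := eqVneq z 0.
      by rewrite {2}/k /kernel_cut eqxx kf ?rho0//= /L; lra.
    rewrite -(kabs z); apply: kdec; [by rewrite normr_gt0|exact: ltW|lra].
  + move=> z /andP[z1 z2]; rewrite -(kabs z); apply: kdec => //; lra.
  + move=> h z hz zh; have -> : diff2 h k z = diff2 h k `|z|.
      by case: (leP 0 z) => z0; [rewrite ger0_norm|rewrite ltr0_norm// diff2N].
    by apply: (tangent_diff2_ge0 T hz); lra.
  + move=> h; rewrite lt_min => /andP[h0 /andP[h1 h2]].
    apply: (bounded_variation_diff2 (f := f) h0 _ _ _ _ _ ki).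
    * lra.
    * lra.
    * by rewrite /L; lra.
    * by move=> z /andP[z1 _]; apply: df; lra.
    * by apply: gbv; rewrite /L; lra.
    * by move=> z /andP[z1 z2]; apply: kf; rewrite z2 andbT; lra.
  + by move=> K e e0; exact: (tangent_tame_near K T ki rho0 lam1 al0 lam2 dk0 dk2).
- by rewrite lt_min divr_gt0//=.
Qed.

End kernel_truncation.

(** * Passage to the limit *)

Section equicontinuous_limit.
Context {R : realType}.
Notation mu := (@lebesgue_measure R).

Lemma ae_itv_point (P : R -> Prop) (c d : R) : c < d ->
  {ae mu, forall x, P x} -> exists2 x, c < x < d & P x.
Proof.
move=> cd [A [mA A0 PA]]; apply: contrapT => H.
have : (mu `]c, d[ <= mu A)%E.
  apply: le_measure; rewrite ?inE// => x /=; rewrite in_itv/= => xcd.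
  by apply: PA => /= Px; apply: H; exists x.
by rewrite A0 lebesgue_measure_itv/= lte_fin cd -EFinB lee_fin subr_le0 leNgt cd.
Qed.

(** A set of full measure meets every interval, so eventual equicontinuity spreads convergence from
    nearby points to every point of the open interval. The pointwise limit inherits the modulus and
    agrees with [f] almost everywhere. *)
Lemma equicontinuous_ae_limit (F : nat -> R -> R) (f : R -> R) (a b : R) :
  (forall d eta : R, 0 < d -> 0 < eta -> exists2 tau : R, 0 < tau &
    \forall n \near \oo, forall x y, a + d <= x <= b - d -> a + d <= y <= b - d ->
      `|x - y| < tau -> `|F n x - F n y| <= eta) ->
  {ae mu, forall x, F n x @[n --> \oo] --> f x} ->
  exists h : R -> R, {within [set` `]a, b[], continuous h} /\
    {ae mu, forall x, x \in `]a, b[ -> f x = h x}.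
Proof.
move=> equi Ff.
have equi_at (x eta : R) : a < x < b -> 0 < eta -> exists2 tau : R, 0 < tau &
    forall y, `|x - y| < tau -> a < y < b /\
      \forall n \near \oo, `|F n x - F n y| <= eta.
  move=> /andP[ax xb] eta0.
  pose d := Num.min (x - a) (b - x) / 2.
  have m1 : Num.min (x - a) (b - x) <= x - a by rewrite ge_min lexx.
  have m2 : Num.min (x - a) (b - x) <= b - x by rewrite ge_min lexx orbT.
  have d0 : 0 < d by rewrite divr_gt0// lt_min !subr_gt0 ax.
  have [tau tau0 H] := equi d eta d0 eta0.
  exists (Num.min tau d); first by rewrite lt_min tau0.
  move=> y; rewrite lt_min => /andP[xy1 xy2].
  move: (xy2); rewrite ltr_norml => /andP[xy3 xy4].
  have yd : a + d <= y <= b - d by rewrite /d in xy3 xy4 *; lra.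
  have xd : a + d <= x <= b - d by rewrite /d in d0 *; lra.
  split; first by lra.
  by apply: filterS H => n /(_ x y xd yd xy1).
have Fcvg x : a < x < b -> cvgn (F ^~ x).
  move=> xab; apply/cauchy_cvgP/cauchy_exP => eps eps0.
  have eps30 : 0 < eps / 3 by lra.
  have [tau tau0 H] := equi_at x _ xab eps30.
  have [|y /andP[xy yx] Fy] := ae_itv_point _ Ff (c := x) (d := x + tau); first lra.
  have [|_ Fxy] := H y; first by rewrite distrC gtr0_norm; lra.
  have h2 : \forall n \near \oo, `|f y - F n y| < eps / 3.
    by move/cvgrPdist_lt : Fy; apply.
  exists (f y); suff : \forall n \near \oo, `|f y - F n x| < eps by [].
  near=> n.
  have H1 : `|F n x - F n y| <= eps / 3 by near: n.
  have H2 : `|f y - F n y| < eps / 3 by near: n.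
  have -> : f y - F n x = (f y - F n y) - (F n x - F n y) by ring.
  by rewrite (le_lt_trans (ler_normB _ _))//; lra.
pose h x := limn (F ^~ x).
exists h; split.
  rewrite continuous_open_subspace; last exact: interval_open.
  move=> x /[!inE] /=; rewrite in_itv/= => xab.
  apply/cvgrPdist_lt => eps eps0.
  have eps20 : 0 < eps / 2 by lra.
  have [tau tau0 H] := equi_at x _ xab eps20.
  near=> y.
  have [|yab Fxy] := H y; first by near: y; exact: cvgr_dist_lt.
  have Fx := Fcvg x xab; have Fy := Fcvg y yab.
  apply: (@le_lt_trans _ _ (eps / 2)); last lra.
  have cn : `|F n x - F n y| @[n --> \oo] --> `|h x - h y|.
    by apply: cvg_norm; exact: cvgB.
  by rewrite -(cvg_lim _ cn)//; apply: limr_le => //; apply/cvg_ex; exists `|h x - h y|.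
case: Ff => A [mA A0 FA]; exists A; split => //.
by apply: subset_trans FA => x /= xN Fx; apply: xN => _; exact/esym/cvg_lim.
Unshelve. all: by end_near. Qed.

End equicontinuous_limit.

(** * A modulus of continuity uniform in the averaging width *)

Section box_average_modulus.
Context {R : realType}.
Notation mu := (@lebesgue_measure R).
Implicit Types (f k : R -> R) (a b c d e x t al del rho M V eta : R).

Lemma box_averageN f e x : measurable_fun [set: R] f -> (exists M, forall y, `|f y| <= M) ->
  box_average e (fun y => - f y) x = - box_average e f x.
Proof.
move=> mf [M fM]; rewrite /box_average -mulrN; congr (_ * _).
under eq_Rintegral do rewrite -mulN1r.
rewrite RintegralZl ?mulN1r//.
exact: (bounded_integrable_itv _ _ (measurable_translate x mf)).
Qed.

Lemma barrier_small M del al eta : 0 < M -> 0 < del -> 0 < al -> 0 < eta ->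
  exists2 tau : R, 0 < tau & forall t, 0 <= t < tau -> barrier M del al t <= eta.
Proof.
move=> M0 del0 al0 eta0.
have q0 : 0 < eta / (2 * M) by rewrite divr_gt0// mulr_gt0.
exists (del * (eta / (2 * M)) `^ al^-1); first by rewrite mulr_gt0// powR_gt0.
move=> t /andP[t0 tt]; rewrite /barrier ger0_norm//.
rewrite -ler_pdivlMl ?mulr_gt0// [leRHS]mulrC.
have -> : eta / (2 * M) = ((eta / (2 * M)) `^ al^-1) `^ al.
  by rewrite -powRrM mulVf ?gt_eqF// powRr1// ltW.
apply: ge0_ler_powR; rewrite ?nnegrE ?powR_ge0 ?divr_ge0 ?(ltW al0) ?(ltW del0)//.
by rewrite ler_pdivrMr// mulrC ltW.
Qed.

(** The average [v] of width [e] is only Lipschitz; a second average of width [e'] satisfies the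
    quadratic bound, and [e'] is then removed because [del] does not see it. The margin [3 * d] is
    [2 * d] for the points where the equation is used plus [e + e' <= d]. The distance [b - a + d]
    leads from any of these points out of the enlarged support. *)
Lemma box_average_modulus k rho V h1 al M d a b :
  tame_kernel k rho (b - a + d) V h1 al -> 0 < rho -> 0 < h1 -> 0 < al <= 2^-1 ->
  0 < M -> 0 < d ->
  exists2 del, 0 < del & forall f c, measurable_fun [set: R] f ->
    (forall y, `|f y| <= M) -> (forall y, ~ (a <= y <= b) -> f y = 0) ->
    {ae mu, forall x, x \in `[a, b] -> \int[mu]_z (k z * f (x - z)) = c} ->
    forall e x0 t, 0 < e <= d / 2 -> a + 3 * d <= x0 <= b - 3 * d -> 0 <= t <= del ->
    `|box_average e f (x0 + t) - box_average e f (x0 - t)| <= barrier M del al t.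
Proof.
move=> tk rho0 h10 al0 M0 d0.
have [del del0 mod] := modulus_estimate tk rho0 h10 al0 M0 d0.
have ki := tame_integrable tk.
exists del => //.
have one f c : measurable_fun [set: R] f ->
    (forall y, `|f y| <= M) -> (forall y, ~ (a <= y <= b) -> f y = 0) ->
    {ae mu, forall x, x \in `[a, b] -> \int[mu]_z (k z * f (x - z)) = c} ->
    forall e x0 t, 0 < e <= d / 2 -> a + 3 * d <= x0 <= b - 3 * d -> 0 <= t <= del ->
    box_average e f (x0 + t) - box_average e f (x0 - t) <= barrier M del al t.
  move=> mf fM f0 fc e x0 t /andP[e0 ed] x0ab tdel.
  set v := box_average e f.
  have vM y : `|v y| <= M by exact: box_average_bound.
  have vlip y y' : `|v y - v y'| <= M / e * `|y - y'| by exact: box_average_lip.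
  have mv : measurable_fun [set: R] v.
    exact: (continuous_measurable_fun (continuous_box_average e0 mf fM)).
  have v0 y : ~ (a - e <= y <= b + e) -> v y = 0 by exact: box_average_out.
  have vc X : a + e <= X <= b - e -> \int[mu]_z (k z * v (X - z)) = c.
    exact: (convolution_box_average e0 ki mf fM fc).
  have vae : {ae mu, forall x, x \in `[(a + e), (b - e)] -> \int[mu]_z (k z * v (x - z)) = c}.
    exists set0; split => // x /=; apply; rewrite in_itv/=; exact: vc.
  apply/ler_addgt0Pr => eps eps0.
  have Me0 : 0 < M / e by rewrite divr_gt0.
  (* The second average moves [v] by at most [M / e * e'] at each of two points, which costs [eps]
     in total. *)
  have [e' [e'0 e'd e'eps]] : exists e', [/\ 0 < e', e' <= d / 2 & M / e * e' <= eps / 2].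
    exists (Num.min (d / 2) (eps / 2 / (M / e))); split.
    - by rewrite lt_min !divr_gt0.
    - by rewrite ge_min lexx.
    - by rewrite mulrC -ler_pdivlMr// ge_min lexx orbT.
  have := mod (box_average e' v) x0 c (M / e / e') (continuous_box_average e'0 mv vM)
    (fun y => box_average_bound y e'0 mv vM)
    (fun y z => box_average_diff2 y z e'0 mv vM vlip).
  have c1 X : `|X - x0| <= 2 * d -> \int[mu]_z (k z * box_average e' v (X - z)) = c.
    rewrite ler_norml => /andP[X1 X2].
    by apply: (convolution_box_average e'0 ki mv vM vae); lra.
  have c2 X z : `|X - x0| <= 2 * d -> b - a + d < `|z| -> box_average e' v (X + z) = 0.
    rewrite ler_norml => /andP[X1 X2] Dz; apply: (box_average_out e'0 v0).
    by move=> /andP[z1 z2]; move: Dz; apply/negP; rewrite -leNgt ler_norml; lra.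
  move=> /(_ c1 c2 t tdel) H.
  have D1 := box_average_lip_dist (x0 + t) e'0 mv vM vlip.
  have D2 := box_average_lip_dist (x0 - t) e'0 mv vM vlip.
  move: D1 D2 H; rewrite !ler_norml => /andP[D1 _] /andP[_ D2] H.
  by move: D1 D2 H e'eps; clear; lra.
move=> f c mf fM f0 fc e x0 t e0 x0ab tdel.
(* The lower bound is the upper bound for [- f], whose potential is [- c]. *)
rewrite ler_norml (one f c)// andbT.
have mNf : measurable_fun [set: R] (fun y => - f y) by exact: measurableT_comp.
have fN x := box_averageN e x mf (ex_intro _ M fM).
have : box_average e (fun y => - f y) (x0 + t) - box_average e (fun y => - f y) (x0 - t)
    <= barrier M del al t.
  apply: (one _ (- c)) => //.
  - by move=> y; rewrite normrN.
  - by move=> y /f0 ->; rewrite oppr0.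
  - case: fc => A [mA A0 FA]; exists A; split => //.
    apply: subset_trans FA => x /= xN Fx; apply: xN => xab; rewrite -(Fx xab).
    rewrite -[RHS]mulN1r -RintegralZl//.
      by apply: eq_Rintegral => z _; ring.
    exact: (integrable_EFin_mul_bounded measurableT ki
      (measurableT_comp mf (measurable_subr x)) (fun z _ => fM _)).
by rewrite !fN; lra.
Qed.

End box_average_modulus.

(** * A bounded, compactly supported representative of the density *)

Section density.
Context {R : realType}.
Notation mu := (@lebesgue_measure R).
Implicit Types (f k : R -> R) (a b c x M D : R).

Lemma Lnorm_oo_ae f M : 'N[mu]_(+oo%E) [EFin \o f]%E = M%:E ->
  {ae mu, forall x, `|f x| <= M}.
Proof.
rewrite unlock /=; case: ifPn => [_ E|].
  have := ess_sup_ge mu (abse \o (EFin \o f)); rewrite E.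
  by apply: ae_imply => x /=; rewrite lee_fin.
(* The other branch of the norm would require the line to be a null set. *)
rewrite -leNgt => muT.
have : (mu (`[0%R, 1%R] : set R) <= mu [set: R])%E by apply: le_measure; rewrite ?inE.
move=> /le_trans/(_ muT); rewrite lebesgue_measure_itv/= lte_fin ltr01 -EFinB lee_fin subr0.
by rewrite ler10.
Qed.

(** The complement of the support is an uncountable union of null open sets, but each of its points
    lies in a null interval with rational endpoints. On such an interval the integral of [f] over
    every measurable subset vanishes, so [f] is 0 almost everywhere there; countably many intervals
    remain. *)
Lemma ae_charge_support f (fi : mu.-integrable [set: R] (EFin \o f)) :
  {ae mu, forall x, ~ charge_support (induced_charge fi) x -> f x = 0}.
Proof.
pose I (pq : rat * rat) : set R := `](ratr pq.1), (ratr pq.2)[%classic.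
pose N (n : nat) : set R :=
  if unpickle n is Some pq then
    (if `[< (induced_charge fi).-null_set (I pq) >] then I pq `&` [set x | f x != 0] else set0)
  else set0.
have N0 n : mu.-negligible (N n).
  rewrite /N; case: unpickle => [pq|]; last exact: negligible_set0.
  case: asboolP => [null|_]; last exact: negligible_set0.
  have mI : measurable (I pq : set (measurableTypeR R)) by exact: measurable_itv.
  have fI : mu.-integrable (I pq) (EFin \o f).
    by have := fi; apply: integrableS.
  have : ae_eq mu (I pq) (EFin \o f) (cst 0%E).
    apply: (integral_ae_eq mI fI) => // E EI mE.
    by rewrite integral_cst// mul0e; exact: null.
  apply: negligibleS => x /= [Ix fx] H; move: fx; apply/negP; rewrite negbK.
  by have [->] := H Ix.
apply: negligibleS (negligible_bigcup N0) => x /= /not_implyP[].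
rewrite /charge_support => /contrapT[U [oU nU] Ux] fx0.
have [e /= e0 eU] : nbhs x U by exact: open_nbhs_nbhs.
have xe1 : x - e < x by rewrite ltrBlDr ltrDl.
have xe2 : x < x + e by rewrite ltrDl.
have [p] := rat_in_itvoo xe1; have [q] := rat_in_itvoo xe2.
rewrite !in_itv/= => /andP[xq qe] /andP[pe px].
have pqU : I (p, q) `<=` U.
  move=> y; rewrite /I/= in_itv/= => /andP[py yq].
  by apply: eU; rewrite /ball/= ltr_norml; move: xq qe pe px py yq; clear; lra.
have pqx : I (p, q) x by rewrite /I/= in_itv/= px.
have Npq : N (pickle (p, q)) = I (p, q) `&` [set x | f x != 0].
  rewrite /N pickleK asboolT//; exact: subset_null_set nU.
exists (pickle (p, q)); first exact: Logic.I.
by rewrite Npq; split => //=; apply/eqP.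
Qed.

(** A representative of [f] for which the bound and the support hold at every point, as the
    pointwise estimates require. *)
Definition truncated_density f a b M x : R :=
  if (a <= x <= b) && (`|f x| <= M) then f x else 0.

Lemma measurable_truncated_density f a b M : measurable_fun [set: R] f ->
  measurable_fun [set: R] (truncated_density f a b M).
Proof.
move=> mf; apply: measurable_fun_ifT => //; apply: measurable_and.
  by apply: measurable_and; exact: measurable_fun_ler.
by apply: measurable_fun_ler => //; exact: measurableT_comp.
Qed.

Lemma truncated_density_bound f a b M x : 0 <= M ->
  `|truncated_density f a b M x| <= M.
Proof.
by move=> M0; rewrite /truncated_density; case: ifP => [/andP[]|_] //; rewrite normr0.
Qed.

Lemma truncated_density_out f a b M x : ~ (a <= x <= b) ->
  truncated_density f a b M x = 0.
Proof. by move=> /negP/negbTE xab; rewrite /truncated_density xab. Qed.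

Lemma ae_truncated_density f a b M (fi : mu.-integrable [set: R] (EFin \o f)) :
  charge_support (induced_charge fi) = [set` `[a, b]] ->
  {ae mu, forall x, `|f x| <= M} ->
  {ae mu, forall x, f x = truncated_density f a b M x}.
Proof.
move=> fab fM; apply: ae_imply (ae_and (ae_charge_support fi) fM) => x [].
rewrite fab /truncated_density => f0 ->; rewrite andbT.
by case: ifPn => // /negP xab; apply: f0; rewrite /= in_itv.
Qed.

(** For [x] and [y] in [[a, b]] the distance is at most [D], so [k] and [g] agree at [x - y] except
    for [y = x], which is a null set. *)
Lemma potential_truncated_density (g : R -> \bar R) f k a b M c D x :
  (forall K : set R, compact K -> mu.-integrable K g) ->
  (forall z, 0 < `|z| <= D -> (k z)%:E = g z) -> b - a <= D ->
  measurable_fun [set: R] f -> measurable_fun [set: R] k ->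
  {ae mu, forall x, f x = truncated_density f a b M x} ->
  a <= x <= b -> potential g f x = c%:E ->
  \int[mu]_z (k z * truncated_density f a b M (x - z)) = c.
Proof.
move=> gi kg Dab mf mk f_ae xab gf.
set f0 := truncated_density f a b M.
have mf0 : measurable_fun [set: R] f0 by exact: measurable_truncated_density.
have mkx : measurable_fun [set: R] (fun y => k (x - y)).
  exact: (measurableT_comp mk (measurable_subr x)).
have mg : measurable_fun [set: R] g.
  have <- : \bigcup_n `[- n%:R, n%:R]%classic = [set: R].
    apply/seteqP; split => // y _; exists (Num.truncn `|y|).+1 => //=.
    by rewrite in_itv/= -ler_norml ltW// truncnS_gt.
  apply/measurable_fun_bigcup => // n.
  have cn : compact (`[- n%:R, n%:R] : set R) by exact: segment_compact.
  exact: measurable_int (gi _ cn).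
have mgx : measurable_fun [set: R] (fun y => g (x - y)).
  exact: (measurableT_comp mg (measurable_subr x)).
have -> : \int[mu]_z (k z * f0 (x - z)) = \int[mu]_y (k (x - y) * f0 y).
  rewrite -[RHS](Rintegral_subr x).
    by apply: eq_Rintegral => z _; rewrite subKr.
  exact: measurable_funM.
rewrite /Rintegral -[RHS]/(fine c%:E) -gf /potential; congr fine.
apply: ae_eq_integral => //.
- by apply/measurable_EFinP; exact: measurable_funM.
- by apply: emeasurable_funM => //; exact/measurable_EFinP.
apply: ae_imply (ae_and (ae_neq x) f_ae) => y [yx fy] _.
rewrite fy -/f0; have [yab|yab] := boolP (a <= y <= b); last first.
  by rewrite /f0 truncated_density_out ?mulr0 ?mule0//; exact/negP.
rewrite EFinM kg// normr_gt0 subr_eq0 eq_sym yx/= ler_norml.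
by move: xab yab Dab; clear; lra.
Qed.

End density.

(** * From equicontinuous averages to a continuous representative *)

Theorem theoremA (R : realType) (g : R -> \bar R)
  (g_ge0 : forall x : R, (0 <= g x)%E)
  (g_hyp : exists r : R, [/\ 0 < r, hypothesis_i g r & hypothesis_ii g r])
  (f : R -> R)
  (f_int : lebesgue_measure.-integrable [set: R] (EFin \o f))
  (a b M : R)
  (f_spt : charge_support (induced_charge f_int) = [set` `[a, b]])
  (f_bnd : 'N[lebesgue_measure]_(+oo%E) [EFin \o f]%E = M%:E)
  (f_pot : exists c : R,
     {ae lebesgue_measure, forall x : R, x \in `[a, b] ->
        potential g f x = c%:E}) :
  exists h : R -> R,
    {within [set` `]a, b[], continuous h} /\
    {ae lebesgue_measure, forall x : R, x \in `]a, b[ -> f x = h x}.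
Proof.
have [r [r0 hi hii]] := g_hyp; have [c fc] := f_pot.
have fM := Lnorm_oo_ae f_bnd.
have M0 : 0 <= M by have [x _] := ae_itv_point ltr01 fM; exact: le_trans.
pose f0 := truncated_density f a b M.
have f_ae : {ae lebesgue_measure, forall x, f x = f0 x} by exact: ae_truncated_density f_spt fM.
have mf : measurable_fun [set: R] f.
  by apply/measurable_EFinP; exact: measurable_int f_int.
have mf0 : measurable_fun [set: R] f0 by exact: measurable_truncated_density.
(* The barrier needs a positive bound, and [M] may be 0. *)
have M10 : 0 < M + 1 by rewrite ltr_wpDl.
have f0M y : `|f0 y| <= M + 1.
  by rewrite (le_trans (truncated_density_bound f a b y M0))// lerDl.
have f0i : lebesgue_measure.-integrable [set: R] (EFin \o f0).
  have := f_int; apply: le_integrable => //; first exact/measurable_EFinP.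
  move=> x _; rewrite lee_fin /f0 /truncated_density.
  by case: ifP => // _; rewrite normr0.
have [|h [ch fh]] := @equicontinuous_ae_limit R
    (fun n => box_average n.+1%:R^-1 f0) f0 a b _ (ae_box_average_cvg f0i).
  move=> d eta d0 eta0.
  have [ba|ab] := leP b a.
    exists 1 => //; apply: nearW => n x y /andP[x1 x2].
    by exfalso; move: x1 x2 ba d0; clear; lra.
  (* The modulus estimate consumes three times its parameter at each endpoint. *)
  have d30 : 0 < d / 3 by rewrite divr_gt0.
  have D0 : 0 < b - a + d / 3 by rewrite addr_gt0// subr_gt0.
  have [k [rho [V [h1 [al [tk rho0 h10 al0 kg]]]]]] := exists_tame_kernel r0 hi hii D0.
  have [del del0 mod] := box_average_modulus tk rho0 h10 al0 M10 d30.
  have al1 : 0 < al by case/andP: al0.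
  have [tau tau0 small] := barrier_small M10 del0 al1 eta0.
  have mk : measurable_fun [set: R] k.
    by apply/measurable_EFinP; exact: measurable_int (tame_integrable tk).
  have [_ gloc _ _] := hi.
  have kc : {ae lebesgue_measure, forall x, x \in `[a, b] ->
      \int[lebesgue_measure]_z (k z * f0 (x - z)) = c}.
    apply: ae_imply fc => x gx xab; apply: (potential_truncated_density gloc kg _ mf mk f_ae).
    - by rewrite lerDl ltW.
    - by move: xab; rewrite in_itv.
    - exact: gx.
  exists (Num.min tau del); first by rewrite lt_min tau0.
  near=> n => x y xd yd xy.
  have n0 : 0 < (n.+1%:R^-1 : R) <= d / 3 / 2.
    rewrite invr_gt0 ltr0n/= ltW//; near: n.
    by apply: near_infty_natSinv_lt (PosNum _); rewrite divr_gt0.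
  wlog xy' : x y xd yd xy / x <= y.
    move=> H; have [|/ltW yx] := leP x y; first exact: H.
    by rewrite distrC; apply: H => //; rewrite distrC.
  move: xy; rewrite distrC ger0_norm ?subr_ge0// lt_min => /andP[xy1 xy2].
  have t1 : 0 <= (y - x) / 2 <= del by move: xy' xy2; clear; lra.
  have t2 : 0 <= (y - x) / 2 < tau by move: xy' xy1; clear; lra.
  have x0 : a + 3 * (d / 3) <= (x + y) / 2 <= b - 3 * (d / 3).
    by move: xd yd; clear; lra.
  have := mod f0 c mf0 f0M (fun y => @truncated_density_out R f a b M y) kc _ _ _ n0 x0 t1.
  have -> : (x + y) / 2 + (y - x) / 2 = y by field.
  have -> : (x + y) / 2 - (y - x) / 2 = x by field.
  by rewrite distrC => /le_trans; apply; exact: small.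
exists h; split => //; apply: ae_imply (ae_and f_ae fh) => x [-> fhx]; exact: fhx.
Unshelve. all: by end_near. Qed.
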